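(* There exists a function $g$ of one variable such that for every tight distance-regular graph $\Gamma$ with classical parameters $(D,b,\alpha,\beta)$, where $D\geq 3$ and $b\geq 2$, the diameter of $\Gamma$ satisfies $D\leq g(b)$.
   Context: Graphs are finite, undirected, connected and simple; $\partial$ is the path-length distance, $\Gamma_i(x)=\{y:\partial(x,y)=i\}$. A connected graph $\Gamma$ with diameter $D$ is distance-regular if for all $0\le h,i,j\le D$ and all vertices $x,y$ with $\partial(x,y)=h$ the number $p^h_{i,j}=|\Gamma_i(x)\cap\Gamma_j(y)|$ depends only on $h,i,j$; write $c_i=p^i_{1,i-1}$, $a_i=p^i_{1,i}$, $b_i=p^i_{1,i+1}$ and $k=b_0$ (the valency). Such a graph has exactly $D+1$ distinct (adjacency) eigenvalues $k=\theta_0>\theta_1>\cdots>\theta_D$. A distance-regular graph with $D\ge 3$ is tight if it is nonbipartite and $$\left(\theta_1+\frac{k}{a_1+1}\right)\left(\theta_D+\frac{k}{a_1+1}\right)=-\frac{k a_1 b_1}{(a_1+1)^2}.$$ For a non-zero integer $b$ put $\left[{i\atop 1}\right]=1+b+b^2+\cdots+b^{i-1}$. A distance-regular graph with diameter $D\ge 3$ has classical parameters $(D,b,\alpha,\beta)$ if $$b_i=\left(\left[{D\atop 1}\right]-\left[{i\atop 1}\right]\right)\left(\beta-\alpha\left[{i\atop 1}\right]\right)\ (0\le i\le D-1),\qquad c_i=\left[{i\atop 1}\right]\left(1+\alpha\left[{i-1\atop 1}\right]\right)\ (1\le i\le D).$$ *)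

(* Defs.v *)
From HB Require Import structures.
From mathcomp Require Import all_boot all_order all_algebra.
From mathcomp Require Import reals.

Set Implicit Arguments.
Unset Strict Implicit.
Unset Printing Implicit Defensive.

Import Order.TTheory GRing.Theory Num.Theory.
Local Open Scope ring_scope.

(* A graph is given by its adjacency relation e on a finite vertex type T. *)

Definition connected_graph (T : finType) (e : rel T) : Prop :=
  [/\ symmetric e, irreflexive e & forall x y, connect e x y].

Definition bipartite (T : finType) (e : rel T) : Prop :=
  exists f : T -> bool, forall x y, e x y -> f x != f y.

(* A shortest path has fewer than #|T| edges; the value #|T| is taken exactly
   when no path joins x to y. *)
Definition gdist (T : finType) (e : rel T) (x y : T) : nat :=
  find (fun n => [exists p : n.-tuple T, path e x p && (last x p == y)])
       (iota 0 #|T|).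

Definition diameter (T : finType) (e : rel T) : nat :=
  (\max_(x : T) \max_(y : T) gdist e x y)%N.

Definition sphere (T : finType) (e : rel T) (i : nat) (x : T) : {set T} :=
  [set y | gdist e x y == i].

Definition distance_regular (T : finType) (e : rel T) : Prop :=
  connected_graph e /\
  forall h i j : nat,
    (h <= diameter e)%N -> (i <= diameter e)%N -> (j <= diameter e)%N ->
    forall x y x' y' : T, gdist e x y = h -> gdist e x' y' = h ->
      #|sphere e i x :&: sphere e j y| = #|sphere e i x' :&: sphere e j y'|.

(* p^h_{i,j}, evaluated at some pair of vertices at distance h; in a
   distance-regular graph the choice of the pair is irrelevant, and such a pair
   exists for every h up to the diameter. *)
Definition pnum (T : finType) (e : rel T) (h i j : nat) : nat :=
  if [pick u : T * T | gdist e u.1 u.2 == h] is Some u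
  then #|sphere e i u.1 :&: sphere e j u.2| else 0%N.

Definition cnum (T : finType) (e : rel T) (i : nat) : nat := pnum e i 1 i.-1.
Definition anum (T : finType) (e : rel T) (i : nat) : nat := pnum e i 1 i.
Definition bnum (T : finType) (e : rel T) (i : nat) : nat := pnum e i 1 i.+1.
Definition valency (T : finType) (e : rel T) : nat := bnum e 0.

Definition adjmx (R : realType) (T : finType) (e : rel T) : 'M[R]_#|T| :=
  \matrix_(i, j) (e (enum_val i) (enum_val j))%:R.

(* theta lists the distinct real eigenvalues in decreasing order, so that
   theta`_i is theta_i; it is uniquely determined by e, and has length D + 1
   when e is distance-regular of diameter D. *)
Definition is_spectrum (R : realType) (T : finType) (e : rel T)
    (theta : seq R) : Prop :=
  sorted >%R theta /\ forall a : R, (a \in theta) = eigenvalue (adjmx R e) a.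

Definition tight (R : realType) (T : finType) (e : rel T) : Prop :=
  let D := diameter e in
  let k : R := (valency e)%:R in
  let a1 : R := (anum e 1)%:R in
  let b1 : R := (bnum e 1)%:R in
  [/\ distance_regular e, (3 <= D)%N, ~ bipartite e &
    exists2 theta : seq R, is_spectrum e theta &
      (theta`_1 + k / (a1 + 1)) * (theta`_D + k / (a1 + 1)) =
        - (k * a1 * b1 / (a1 + 1) ^+ 2)].

Definition gauss1 (R : realType) (b : int) (i : nat) : R :=
  \sum_(j < i) b%:~R ^+ j.

Definition classical_parameters (R : realType) (T : finType) (e : rel T)
    (D : nat) (b : int) (alpha beta : R) : Prop :=
  [/\ distance_regular e, diameter e = D, (3 <= D)%N, b != 0 &
    (forall i : nat, (i <= D.-1)%N ->
       (bnum e i)%:R =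
         (gauss1 R b D - gauss1 R b i) * (beta - alpha * gauss1 R b i)) /\
    (forall i : nat, (1 <= i <= D)%N ->
       (cnum e i)%:R = gauss1 R b i * (1 + alpha * gauss1 R b i.-1))].

(* Main.v *)
Require Import Defs.
From mathcomp Require Import all_boot all_order all_algebra.
From mathcomp Require Import reals zify ring lra.

(** Write q = b, m = q + 1 and X = 1 + q + .. + q^(D-2).  The proof studies the
    local graph at a vertex x, i.e. the graph induced on the neighbours of x.

    The classical formulas determine the spectrum: on functions of the distance
    to x the adjacency operator is tridiagonal, and it becomes triangular in the
    basis of the products of the (q^-i - q^-l) ([radial_tau], [spectrumE]).  With
    theta_1 and theta_D known explicitly, tightness is a polynomial identity that
    forces beta = 1 + alpha X ([tight_beta]); as the graph is not bipartite,
    alpha > 0 ([alpha_gt0]).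

    For each of theta_1 and theta_D the matrix of the cosines f(d(y,z)) is, up to
    a positive factor, its own square, hence a Gram matrix ([eigen_square]).
    Restricted to the neighbours of x and centred, the two matrices have a
    product of trace 0 exactly because of tightness, so their product vanishes,
    and this equation says that the local graph is strongly regular, with
    smallest eigenvalue -m and mu = t = m alpha ([local_srg]).

    The multiplicity f of its eigenvalue r = alpha (X - 1) is an integer, and the
    local graph is a two-distance set in dimension f, so that the valency is at
    most (f + 1)^2 ([local_rank]).  The second fact bounds t by a function of q
    ([multiplicity_bound]); the first one makes t (X - 1) + m^2 divide
    m q (t - m^2) (t - m q), which bounds X unless alpha = q or alpha = q + 1
    ([multiplicity_dvd]).

    In these two cases, the parameters of the block graphs of orthogonal arrays
    and of Steiner systems, a clique argument in the style of Bruck and Bose gives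
    lines in the local graph when X is large.  For z at distance 2 from x let C be
    the set of common neighbours of x and z.  By a variance computation, a
    neighbour of x outside C is adjacent to 0 or to alpha + 1 elements of C
    ([mu_graph_outside]).  Hence C behaves like a subarray (or an affine
    subplane), and it is determined by any two of its points; but any two
    nonadjacent points lie in such a C, and this puts more points in one C than
    it has ([closed_subsets_contradiction]). *)

Set Implicit Arguments.
Unset Strict Implicit.
Unset Printing Implicit Defensive.

Import Order.TTheory GRing.Theory Num.Theory.

(** * Sums of cardinalities *)

Section FiniteSums.

Lemma card_bigcup_le (I V : finType) (A : {set I}) (F : I -> {set V}) :
  #|\bigcup_(i in A) F i| <= \sum_(i in A) #|F i|.
Proof.
apply: (big_ind2 (fun (B : {set V}) n => #|B| <= n)) => //.
  by rewrite cards0.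
by move=> B n C p hB hC; apply: leq_trans (leq_card_setU B C) (leq_add hB hC).
Qed.

Lemma sum_card_disjoint (I V : finType) (A : {set I}) (F : I -> {set V})
    (B : {set V}) :
    (forall i, i \in A -> F i \subset B) ->
    (forall i j v, i \in A -> j \in A -> v \in F i -> v \in F j -> i = j) ->
  \sum_(i in A) #|F i| <= #|B|.
Proof.
move=> sFB disj.
have -> : \sum_(i in A) #|F i| = \sum_(v in B) #|[set i in A | v \in F i]|.
  under eq_bigr => i iA.
    rewrite -sum1_card big_mkcond /=.
    rewrite (bigID (mem B)) /= [X in (_ + X)%N]big1 ?addn0.
    over.
    by move=> v vB; case: ifP => // /(subsetP (sFB i iA)); rewrite (negbTE vB).
  rewrite exchange_big /=; apply: eq_bigr => v vB.
  rewrite -sum1_card -big_mkcondr /=.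
  by apply: eq_bigl => i; rewrite inE.
rewrite -sum1_card; apply: leq_sum => v vB.
apply/card_le1_eqP => i j; rewrite !inE => /andP[iA vi] /andP[jA vj].
exact: (disj j i v).
Qed.

End FiniteSums.

(** * Lines and closed subsets in a strongly regular graph *)

(** The inequalities below are linear once every product of two variables is
    treated as an unknown, which is far cheaper than nonlinear search. *)
Ltac name_products :=
  repeat match goal with
  | |- context [muln ?a ?b] =>
      lazymatch a with S _ => fail | _ => idtac end;
      let x := fresh "x" in set (x := muln a b) in *; clearbody x
  | H : context [muln ?a ?b] |- _ =>
      lazymatch a with S _ => fail | _ => idtac end;
      let x := fresh "x" in set (x := muln a b) in *; clearbody x
  end.
Ltac linear :=
  intros; name_products;
  lazymatch goal with
  | |- is_true (leq _ _) => idtac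
  | |- _ = _ :> nat => idtac
  | |- _ => exfalso
  end;
  repeat match goal with
  | H : is_true (leq _ _) |- _ => revert H
  | H : _ = _ :> nat |- _ => revert H
  end; clear; lia.

Section Lines.

Variables (V : finType) (Delta : {set V}) (adj : rel V).
Hypothesis adj_sym : symmetric adj.
Hypothesis adj_irr : irreflexive adj.
Hypothesis adj_in : forall y z, adj y z -> y \in Delta.

Let N y := [set z | adj y z].

(* The parameters of a partial geometry with m lines of l + 1 points through
   each point, in which a point off a line is collinear with h points of it. *)
Variables m h l : nat.
Hypothesis m_ge3 : 3 <= m.
Hypothesis h_ge2 : 2 <= h.
Hypothesis degN : forall y, y \in Delta -> #|N y| = m * l.
Hypothesis lamN : forall y z, adj y z ->
  #|N y :&: N z|.+1 = l + m.-1 * h.-1.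
Hypothesis muN : forall y z, y \in Delta -> z \in Delta -> y != z ->
  ~~ adj y z -> #|N y :&: N z| = m * h.
(* Only the existence of some bound depending on m and h matters. *)
Hypothesis l_large : 9 * (m * (m * (m * h))) < l.

Let delta_le : m.-1 * h.-1 <= m * h.
Proof. by apply: leq_mul; apply: leq_pred. Qed.

Let m_le : m <= m * h.
Proof. by rewrite leq_pmulr // (leq_trans _ h_ge2). Qed.

Let mh_le : 3 * (m * h) <= m * (m * h).
Proof. by rewrite leq_mul2r m_ge3 orbT. Qed.

Let mmh_le : 3 * (m * (m * h)) <= m * (m * (m * h)).
Proof. by rewrite leq_mul2r m_ge3 orbT. Qed.

Definition independent (S : {set V}) :=
  [forall s in S, forall t in S, ~~ adj s t].

Definition clique (K : {set V}) :=
  [forall s in K, forall t in K, (s != t) ==> adj s t].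

Lemma independentP (S : {set V}) :
  reflect {in S &, forall s t, ~~ adj s t} (independent S).
Proof.
apply: (iffP forall_inP) => [H s t sS tS | H s sS].
  exact: (forall_inP (H s sS)).
by apply/forall_inP => t tS; apply: H.
Qed.

Lemma cliqueP (K : {set V}) :
  reflect {in K &, forall s t, s != t -> adj s t} (clique K).
Proof.
apply: (iffP forall_inP) => [H s t sS tS st | H s sS].
  by have /forall_inP/(_ t tS)/implyP := H s sS; apply.
by apply/forall_inP => t tS; apply/implyP => st; apply: H.
Qed.

(** When S is a maximal independent subset of N(y), this is the line through y
    and s without y, up to a bounded number of exceptions. *)
Definition exclusive y (S : {set V}) s :=
  (N y :&: (s |: N s)) :\: \bigcup_(t in S :\ s) N t.

(** s and its neighbours make up lambda + 1 elements of N(y), and each other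
    element of S takes away at most mu of them. *)
Lemma card_exclusive y (S : {set V}) s : S \subset N y -> independent S ->
  s \in S ->
  l + m.-1 * h.-1 <= #|exclusive y S s| + #|S|.-1 * (m * h).
Proof.
move=> sSN /independentP indS sS.
have ys : adj y s by have := subsetP sSN s sS; rewrite inE.
have cardA : #|N y :&: (s |: N s)| = l + m.-1 * h.-1.
  rewrite -(lamN ys).
  have -> : N y :&: (s |: N s) = s |: (N y :&: N s).
    apply/setP => z; rewrite !inE; case: eqP => [-> | _] //=.
    by rewrite ys.
  by rewrite cardsU1 !inE adj_irr andbF.
rewrite -cardA -(cardsID (\bigcup_(t in S :\ s) N t)) addnC /exclusive.
rewrite leq_add2l.
have sub : N y :&: (s |: N s) :&: \bigcup_(t in S :\ s) N t
    \subset \bigcup_(t in S :\ s) (N s :&: N t).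
  apply/subsetP => z; rewrite inE => /andP[zA /bigcupP[t tS zt]].
  apply/bigcupP; exists t => //; rewrite inE zt andbT.
  move: zA; rewrite !inE => /andP[_ /orP[/eqP zs|//]].
  move: zt; rewrite zs inE => ts.
  by move: tS; rewrite !inE => /andP[_ tS]; have := indS t s tS sS; rewrite ts.
apply: leq_trans (subset_leq_card sub) _.
apply: leq_trans (card_bigcup_le _ _) _.
have -> : #|S|.-1 = #|S :\ s| by rewrite (cardsD1 s S) sS.
rewrite -sum_nat_const; apply: leq_sum => t; rewrite !inE => /andP[ts tS].
have yt : adj y t by have := subsetP sSN t tS; rewrite inE.
rewrite muN //.
- by apply: (@adj_in s y); rewrite adj_sym.
- by apply: (@adj_in t y); rewrite adj_sym.
- by rewrite eq_sym.
exact: indS.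
Qed.

(** The exclusive parts of m + 1 independent elements of N(y) are disjoint and
    have about l elements each, whereas N(y) has only m l elements. *)
Lemma independent_le y (S : {set V}) : y \in Delta -> S \subset N y ->
  independent S ->
  #|S| <= m.
Proof.
move=> yD sSN indS; rewrite leqNgt; apply/negP => /card_geqP[s [us ss sub]].
pose S' := [set z in s].
have cS' : #|S'| = m.+1 by rewrite cardsE (card_uniqP us).
have sS'S : S' \subset S by apply/subsetP => z; rewrite inE => /sub.
have indS' : independent S'.
  apply/independentP => a b aS bS.
  by apply: (independentP _ indS); apply: (subsetP sS'S).
have sS'N : S' \subset N y by apply: subset_trans sSN.
have : \sum_(s in S') #|exclusive y S' s| <= #|N y|.
  apply: sum_card_disjoint => [i _ | i j v iS jS].
    by apply/subsetP => v; rewrite !inE => /andP[_ /andP[]].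
  rewrite !inE => /andP[nvi /andP[_ vi]] /andP[nvj /andP[_ vj]].
  apply/eqP; apply: contraT => ij.
  have nadj a b : a \in S' -> a != b -> v \notin \bigcup_(t in S' :\ b) N t ->
      ~~ adj a v.
    move=> aS ab; apply: contra => av; apply/bigcupP; exists a; rewrite !inE//.
    by rewrite ab; move: aS; rewrite inE.
  move: vi.
  rewrite (negbTE (nadj i j iS ij nvj)) orbF => /eqP vi.
  rewrite eq_sym in ij; move: vj.
  rewrite (negbTE (nadj j i jS ij nvi)) orbF => /eqP vj.
  by rewrite -vi vj eqxx in ij.
rewrite degN //.
have low : \sum_(s in S') (l - m * (m * h)) <=
    \sum_(s in S') #|exclusive y S' s|.
  apply: leq_sum => t tS; have := card_exclusive sS'N indS' tS.
  by rewrite cS' leq_subLR [X in _ -> _ <= X]addnC; apply: leq_trans;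
    apply: leq_addr.
move/(leq_trans low); rewrite sum_nat_const cS'.
rewrite mulnBr !mulSn; linear.
Qed.

(** Each s covers itself and lambda further elements, about l in all, so fewer
    than m of them cannot cover N(y). *)
Lemma max_independent_card y (S : {set V}) : y \in Delta -> S \subset N y ->
    independent S ->
    (forall z, z \in N y -> exists2 s, s \in S & z \in s |: N s) ->
  #|S| = m.
Proof.
move=> yD sSN indS cov; apply/eqP; rewrite eqn_leq.
rewrite (independent_le yD sSN indS) /= leqNgt; apply/negP => Sm.
have sub : N y \subset \bigcup_(s in S) (N y :&: (s |: N s)).
  apply/subsetP => z zy; have [s sS zs] := cov z zy.
  by apply/bigcupP; exists s => //; rewrite inE zy.
have := leq_trans (subset_leq_card sub) (card_bigcup_le _ _).
have -> : \sum_(i in S) #|N y :&: (i |: N i)| =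
    \sum_(i in S) (l + m.-1 * h.-1).
  apply: eq_bigr => s sS.
  have ys : adj y s by have := subsetP sSN s sS; rewrite inE.
  rewrite -(lamN ys).
  have -> : N y :&: (s |: N s) = s |: (N y :&: N s).
    apply/setP => z; rewrite !inE; case: eqP => [-> | _] //=.
    by rewrite ys.
  by rewrite cardsU1 !inE adj_irr andbF.
rewrite sum_nat_const degN // => le1.
have : m * l <= m.-1 * (l + m * h).
  apply: leq_trans le1 _; apply: leq_mul; first by case: (m) Sm.
  by rewrite leq_add2l.
have : m.-1 * (m * h) <= m * (m * h) by rewrite leq_mul2r leq_pred orbT.
have : m * l = l + m.-1 * l by rewrite -mulSn prednK // (leq_trans _ m_ge3).
by rewrite mulnDr; linear.
Qed.

(** Complete {w} to a maximal independent subset S of N(y).  The exclusive part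
    of w is a clique: two nonadjacent elements of it could replace w in S, giving
    m + 1 independent elements. *)
Lemma edge_in_large_clique y w : adj y w ->
  exists K, [/\ clique K, y \in K, w \in K & l <= #|K| + m * (m * h)].
Proof.
move=> yw.
have yD := adj_in yw.
have wD : w \in Delta by apply: (@adj_in w y); rewrite adj_sym.
pose P (S : {set V}) := (S \subset N y) && independent S.
have P1 : P [set w].
  rewrite /P sub1set inE yw; apply/independentP => a b.
  by rewrite !inE => /eqP -> /eqP ->; rewrite adj_irr.
have [S /maxsetP[/andP[sSN indS] maxS] sw] := maxset_exists P1.
have wS : w \in S by rewrite -sub1set.
have cS : #|S| = m.
  apply: (max_independent_card yD sSN indS) => z zy.
  have [/existsP[s /andP[sS sz]] | no] := boolP [exists s in S, z \in s |: N s].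
    by exists s.
  have PzS : P (z |: S).
    rewrite /P subUset sub1set zy sSN /=; apply/independentP => a b.
    have nz s : s \in S -> ~~ adj s z.
      by move=> sS; apply: contra no => sz; apply/existsP; exists s;
         rewrite sS !inE sz orbT.
    rewrite !inE => /orP[/eqP->|aS] /orP[/eqP->|bS].
    - by rewrite adj_irr.
    - by rewrite adj_sym nz.
    - exact: nz.
    - exact: (independentP _ indS).
  have zS : z \in S by rewrite -(maxS _ PzS (subsetUr _ _)) setU11.
  by exists z; rewrite ?setU11.
have EN u : u \in exclusive y S w -> adj y u.
  by rewrite !inE => /andP[_ /andP[]].
exists (y |: exclusive y S w); split.
- apply/cliqueP => a b.
  rewrite in_setU1 (in_setU1 b) => /orP[/eqP->|aE] /orP[/eqP->|bE] ab.
  + by rewrite eqxx in ab.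
  + exact: EN.
  + by rewrite adj_sym EN.
  apply: contraT => nab.
  have nS u t : u \in exclusive y S w -> t \in S :\ w -> ~~ adj t u.
    move=> uE tS; apply/negP => tu; move: uE; rewrite inE => /andP[nb _].
    by case/bigcupP: nb; exists t; rewrite // inE.
  have aS : a \notin S :\ w.
    apply/negP => aS; have : a \in w |: N w.
      by move: aE; rewrite !inE => /andP[_ /andP[]].
    move: (aS); rewrite !inE => /andP[aw aS'].
    by rewrite (negbTE aw) /= (negbTE (independentP _ indS w a wS aS')).
  have bS : b \notin S :\ w.
    apply/negP => bS; have : b \in w |: N w.
      by move: bE; rewrite !inE => /andP[_ /andP[]].
    move: (bS); rewrite !inE => /andP[bw bS'].
    by rewrite (negbTE bw) /= (negbTE (independentP _ indS w b wS bS')).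
  (* w is replaced by two nonadjacent elements of its exclusive part. *)
  pose S2 := a |: (b |: S :\ w).
  have cS2 : #|S2| = m.+1.
    rewrite cardsU1 cardsU1 bS in_setU1 (negbTE ab) (negbTE aS) /=.
    by rewrite !add1n -cS (cardsD1 w S) wS.
  suff : #|S2| <= m by rewrite cS2 ltnn.
  apply: (independent_le yD).
    rewrite !subUset !sub1set !inE !EN //=.
    by apply: subset_trans sSN; apply: subsetDl.
  apply/independentP => u v; rewrite !in_setU1.
  have nl t : t \in S :\ w -> (adj a t = false) * (adj b t = false).
    by move=> tS; rewrite ![adj _ t]adj_sym !(negbTE (nS _ _ _ tS)).
  case/or3P => [/eqP->|/eqP->|uS]; case/or3P => [/eqP->|/eqP->|vS];
    rewrite ?adj_irr //; try by [rewrite adj_sym | rewrite !nl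
      | exact: (nS a) | exact: (nS b)].
  apply: (independentP _ indS).
    by move: uS; rewrite inE => /andP[].
  by move: vS; rewrite inE => /andP[].
- exact: setU11.
- rewrite !inE; apply/orP; right; rewrite eqxx yw /= andbT.
  apply/negP => /bigcupP[t]; rewrite !inE => /andP[_ tS].
  by rewrite (negbTE (independentP _ indS t w tS wS)).
have := card_exclusive sSN indS wS; rewrite cS => /(leq_trans (leq_addr _ _))
  le1.
have := subset_leq_card (subsetUr [set y] (exclusive y S w)).
have : m.-1 * (m * h) <= m * (m * h) by rewrite leq_mul2r leq_pred orbT.
linear.
Qed.

(** The grand cliques of Bruck and Bose. *)
Definition line (K : {set V}) :=
  maxset clique K && (l <= #|K| + m * (m * h)).

Lemma line_adj (K : {set V}) y w : line K -> y \in K -> w \in K -> y != w ->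
  adj y w.
Proof.
move=> /andP[/maxsetP[cK _] _] yK wK; exact: (cliqueP _ cK).
Qed.

Lemma line_exists y w : adj y w -> exists K, [/\ line K, y \in K & w \in K].
Proof.
move=> yw; have [K0 [cK0 yK0 wK0 szK0]] := edge_in_large_clique yw.
have [K mK sK] := maxset_exists cK0.
exists K; split; try exact: (subsetP sK).
by rewrite /line mK (leq_trans szK0) // leq_add2r subset_leq_card.
Qed.

(** Two distinct maximal cliques share at most mu vertices, because some vertex
    of one is not adjacent to some vertex of the other.  If both are large and
    contain y and w, their union does not fit into the lambda common neighbours
    of y and w. *)
Lemma line_unique (K1 K2 : {set V}) y w : line K1 -> line K2 -> y != w ->
  y \in K1 -> w \in K1 -> y \in K2 -> w \in K2 -> K1 = K2.
Proof.
move=> L1 L2 yw y1 w1 y2 w2.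
have a1 := line_adj L1; have a2 := line_adj L2.
have /andP[/maxsetP[cK1 max1] sz1] := L1.
have /andP[/maxsetP[cK2 max2] sz2] := L2.
apply/eqP; apply: contraT => K12.
have /subsetPn[u1 u1K1 u1K2] : ~~ (K1 \subset K2).
  by apply: contra K12 => s12; rewrite (max1 _ cK2 s12).
have [u2 u2K2 nu] : exists2 u2, u2 \in K2 & ~~ adj u1 u2.
  apply/exists_inP; apply: contraT => /exists_inPn all_adj.
  have adj1 u : u \in K2 -> adj u1 u.
    by move=> uK; have := all_adj u uK; rewrite negbK.
  have cK : clique (u1 |: K2).
    apply/cliqueP => a b; rewrite !in_setU1.
    move=> /orP[/eqP->|aK] /orP[/eqP->|bK] ab.
    - by rewrite eqxx in ab.
    - exact: adj1.
    - by rewrite adj_sym adj1.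
    - exact: a2.
  by rewrite -(max2 _ cK (subsetUr _ _)) setU11 in u1K2.
have u12 : u1 != u2 by apply: contraNneq u1K2 => ->.
have u2K1 : u2 \notin K1.
  by apply: contra nu => u2K1; apply: a1.
have D1 : u1 \in Delta.
  have [e | ne] := eqVneq u1 y; first by move: u1K2; rewrite e y2.
  exact: adj_in (a1 _ _ u1K1 y1 ne).
have D2 : u2 \in Delta.
  have [e | ne] := eqVneq u2 y; first by move: u2K1; rewrite e y1.
  exact: adj_in (a2 _ _ u2K2 y2 ne).
have leI : #|K1 :&: K2| <= m * h.
  rewrite -(muN D1 D2 u12 nu); apply: subset_leq_card.
  apply/subsetP => z; rewrite !inE => /andP[z1 z2].
  rewrite a1 //=; last by apply: contraNneq u1K2 => ->.
  by apply: a2 => //; apply: contraNneq u2K1 => ->.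
have leU : #|K1 :|: K2| <= (#|N y :&: N w|).+2.
  have <- : #|y |: (w |: (N y :&: N w))| = (#|N y :&: N w|).+2.
    by rewrite !cardsU1 !inE (negbTE yw) !adj_irr /= ?andbF ?andFb.
  apply: subset_leq_card; apply/subsetP => z; rewrite !inE.
  have [//|zy] := eqVneq z y; have [//|zw] := eqVneq z w.
  rewrite /= ![adj _ z]adj_sym.
  by move=> /orP[zK|zK]; [rewrite !a1 | rewrite !a2].
have := cardsUI K1 K2; have := lamN (a1 _ _ y1 w1 yw).
linear.
Qed.

(** Distinct lines through y only share y, and each of them takes about l of
    the m l neighbours of y. *)
Lemma lines_through y : y \in Delta -> #|[set K | line K & y \in K]| <= m.
Proof.
move=> yD; rewrite leqNgt; apply/negP => gt.
have : \sum_(K in [set K | line K & y \in K]) #|K :\ y| <= #|N y|.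
  apply: sum_card_disjoint => [K | K1 K2 v].
    rewrite inE => /andP[LK yK]; apply/subsetP => v.
    by rewrite !inE => /andP[vy vK]; apply: (line_adj LK); rewrite // eq_sym.
  rewrite !inE => /andP[L1 y1] /andP[L2 y2] /andP[vy v1] /andP[_ v2].
  exact: (line_unique L1 L2 vy).
have low : \sum_(K in [set K | line K & y \in K]) (l - (m * (m * h)).+1) <=
    \sum_(K in [set K | line K & y \in K]) #|K :\ y|.
  apply: leq_sum => K; rewrite inE => /andP[/andP[_ sz] yK].
  by move: sz; rewrite (cardsD1 y K) yK; linear.
move/(leq_trans low); rewrite sum_nat_const degN // => le1.
have : m.+1 * (l - (m * (m * h)).+1) <= m * l.
  by apply: leq_trans le1; rewrite leq_mul2r gt orbT.
by rewrite mulnBr !mulSn mulnS; linear.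
Qed.

Section Subgeometry.

(** The common neighbours of x and of a vertex at distance 2 from x form such a
    set in the local graph at x.  In the block graph of an orthogonal array
    (h + 1 = m) the model is a subarray on m symbols; in that of a Steiner system
    (h = m) it is an affine subplane of order m. *)
Definition closed_subset (C : {set V}) :=
  [/\ C \subset Delta, #|C| = m * h.+1,
      forall y, y \in C -> #|N y :&: C| = m * h
    & forall u, u \in Delta -> u \notin C ->
        #|N u :&: C| = 0 \/ #|N u :&: C| = h.+1].

Variable C : {set V}.
Hypothesis C_closed : closed_subset C.

Let subCD : C \subset Delta. Proof. by case: C_closed. Qed.

(** A line is larger than C, so it has a point outside C, and that point sees
    the whole of the intersection. *)
Lemma line_meet_le (L : {set V}) y : line L -> y \in L -> y \in C ->
  #|L :&: C| <= h.+1.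
Proof.
have [_ cC _ outC] := C_closed.
move=> lL yL yC; have /andP[_ sz] := lL.
have [u uL uC] : exists2 u, u \in L & u \notin C.
  apply/subsetPn; apply/negP => sLC; have := subset_leq_card sLC.
  by rewrite cC mulnS; linear.
have uy : u != y by apply: contraNneq uC => ->.
have au := line_adj lL uL yL uy.
have sub : L :&: C \subset N u :&: C.
  apply/subsetP => z; rewrite !inE => /andP[zL zC]; rewrite zC andbT.
  by apply: (line_adj lL) => //; apply: contraNneq uC => ->.
have [z0|<-] := outC u (adj_in au) uC; last exact: subset_leq_card.
have : y \in N u :&: C by rewrite !inE au.
by rewrite (cards0_eq z0) inE.
Qed.

(** The at most m lines through y cover the m h neighbours of y in C, and each
    contributes at most h of them, so all of them contribute exactly h. *)
Lemma line_meet (L : {set V}) y : line L -> y \in L -> y \in C -> #|L :&: C| =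
  h.+1.
Proof.
move=> lL yL yC; have [_ _ inC _] := C_closed.
have yD := subsetP subCD y yC.
pose Ly := [set K | line K & y \in K].
have LLy : L \in Ly by rewrite inE lL.
have cover : N y :&: C \subset \bigcup_(K in Ly) ((K :&: C) :\ y).
  apply/subsetP => z; rewrite !inE => /andP[yz zC].
  have [K [lK yK zK]] := line_exists yz.
  apply/bigcupP; exists K; first by rewrite inE lK.
  rewrite !inE zK zC !andbT.
  by apply: contraTneq yz => ->; rewrite adj_irr.
have := leq_trans (subset_leq_card cover) (card_bigcup_le _ _).
rewrite inC // (bigD1 L) //=.
have leh K : K \in Ly -> #|(K :&: C) :\ y| <= h.
  rewrite inE => /andP[lK yK].
  have := line_meet_le lK yK yC; rewrite (cardsD1 y (K :&: C)).
  by rewrite inE yK yC.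
have : \sum_(K in Ly | K != L) #|(K :&: C) :\ y| <= m.-1 * h.
  apply: leq_trans (_ : \sum_(K in Ly :\ L) h <= _).
    rewrite (eq_bigl (mem (Ly :\ L))); last by move=> K; rewrite !inE andbC.
    by apply: leq_sum => K; case/setD1P => _ /leh.
  rewrite sum_nat_const leq_mul2r; apply/orP; right.
  by have := lines_through yD; rewrite -/Ly (cardsD1 L Ly) LLy add1n; case: (m).
have := line_meet_le lL yL yC; rewrite (cardsD1 y (L :&: C)) inE yL yC.
have : m * h = h + m.-1 * h by rewrite -mulSn prednK // (leq_trans _ m_ge3).
rewrite /=; linear.
Qed.

(** Otherwise u would see 2 (h + 1) points of C. *)
Lemma two_lines (L1 L2 : {set V}) y1 y2 u : line L1 -> line L2 -> L1 != L2 ->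
  y1 \in L1 -> y1 \in C -> y2 \in L2 -> y2 \in C ->
  u \in L1 -> u \in L2 -> u \in C.
Proof.
move=> l1 l2 L12 yL1 yC1 yL2 yC2 u1 u2; apply: contraT => uC.
have [_ _ _ outC] := C_closed.
have uy1 : u != y1 by apply: contraNneq uC => ->.
have au := line_adj l1 u1 yL1 uy1.
have sub : (L1 :&: C) :|: (L2 :&: C) \subset N u :&: C.
  apply/subsetP => z; rewrite !inE => /orP[] /andP[zL zC]; rewrite zC andbT.
    by apply: (line_adj l1) => //; apply: contraNneq uC => ->.
  by apply: (line_adj l2) => //; apply: contraNneq uC => ->.
have := cardsUI (L1 :&: C) (L2 :&: C).
rewrite (line_meet l1 yL1 yC1) (line_meet l2 yL2 yC2).
have -> : (L1 :&: C) :&: (L2 :&: C) = set0.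
  apply/setP => z; rewrite !inE; apply/negP => /andP[/andP[z1 zC] /andP[z2 _]].
  have zu : z != u by apply: contraNneq uC => <-.
  by rewrite (line_unique l1 l2 zu z1 u1 z2 u2) eqxx in L12.
rewrite cards0 addn0; have := subset_leq_card sub.
by have [->|->] := outC u (adj_in au) uC; linear.
Qed.

Lemma common_in y y' : y \in C -> y' \in C -> y != y' -> ~~ adj y y' ->
  N y :&: N y' \subset C.
Proof.
move=> yC y'C yy' nadj; apply/subsetP => w; rewrite !inE => /andP[yw y'w].
have [L1 [l1 yL1 wL1]] := line_exists yw.
have [L2 [l2 yL2 wL2]] := line_exists y'w.
apply: (two_lines l1 l2 _ yL1 yC yL2 y'C wL1 wL2).
by apply: contraNneq nadj => L12; apply: (line_adj l1); rewrite // L12.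
Qed.

(** Both sides have m h elements.  In particular nonadjacency is an equivalence
    relation on C: the graph on C is complete multipartite. *)
Lemma nbr_in y y' : y \in C -> y' \in C -> y != y' -> ~~ adj y y' ->
  N y :&: C = N y :&: N y'.
Proof.
move=> yC y'C yy' nadj; have [_ _ inC _] := C_closed.
apply/esym/eqP; rewrite eqEcard; apply/andP; split.
  by rewrite subsetI subsetIl /= common_in.
by rewrite inC // muN //; apply: (subsetP subCD).
Qed.

Lemma off_line_in y w (L : {set V}) u : y \in C -> w \in C -> y != w ->
  line L -> y \in L -> w \in L -> u \notin L -> adj y u -> adj w u -> u \in C.
Proof.
move=> yC wC yw lL yL wL uL yu wu.
have [L1 [l1 yL1 uL1]] := line_exists yu.
have [L2 [l2 wL2 uL2]] := line_exists wu.
apply: (two_lines l1 l2 _ yL1 yC wL2 wC uL1 uL2).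
apply: contraNneq uL => L12; rewrite -L12 in wL2.
by rewrite -(line_unique l1 lL yw).
Qed.

(** The classes of nonadjacency in C have m elements, and a clique has at most
    one point in each of the h + 1 classes. *)
Lemma clique_in (K : {set V}) : K \subset C -> clique K -> #|K| <= h.+1.
Proof.
move=> sKC /cliqueP cK; have [_ cC inC _] := C_closed.
have : \sum_(u in K) #|C :\: N u| <= #|C|.
  apply: sum_card_disjoint => [u _ | u v p uK vK]; first exact: subsetDl.
  rewrite !inE => /andP[up pC] /andP[vp _].
  apply/eqP; apply: contraT => uv.
  have uC := subsetP sKC u uK; have vC := subsetP sKC v vK.
  have auv := cK u v uK vK uv.
  have pu : p != u by apply: contraNneq vp => ->; rewrite adj_sym.
  have nup : ~~ adj p u by rewrite adj_sym.
  have e1 := nbr_in pC uC pu nup.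
  rewrite eq_sym in pu; have e2 := nbr_in uC pC pu up.
  have : v \in N u :&: C by rewrite !inE auv.
  by rewrite e2 setIC -e1 !inE adj_sym (negbTE vp).
have -> : \sum_(u in K) #|C :\: N u| = \sum_(u in K) m.
  apply: eq_bigr => u uK; have uC := subsetP sKC u uK.
  have := cardsID (N u) C; rewrite setIC inC // cC mulnS addnC.
  by move/eqP; rewrite eqn_add2r => /eqP.
by rewrite sum_nat_const cC mulnC leq_pmul2l // (leq_trans _ m_ge3).
Qed.

End Subgeometry.

(** C1 and C2 both contain the m h common neighbours of y and y'.  A remaining
    point of C1 is adjacent to all of these, hence to more than h + 1 points of
    C2, so it cannot lie outside C2. *)
Lemma closed_unique_nonadj (C1 C2 : {set V}) y y' : closed_subset C1 ->
  closed_subset C2 ->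
  y != y' -> ~~ adj y y' -> y \in C1 -> y' \in C1 -> y \in C2 -> y' \in C2 ->
  C1 = C2.
Proof.
move=> cl1 cl2 yy' nadj y1 y'1 y2 y'2.
have [s1 c1 in1 _] := cl1; have [s2 c2 in2 out2] := cl2.
apply/eqP; rewrite eqEcard c1 c2 leqnn andbT; apply/subsetP => p pC1.
have e1 := nbr_in cl1 y1 y'1 yy' nadj.
have sN2 := common_in cl2 y2 y'2 yy' nadj.
have [yp | nyp] := boolP (adj y p).
  by apply: (subsetP sN2); rewrite -e1 !inE yp.
have [<- // | yp] := eqVneq y p.
apply: contraT => pC2.
have e2 := nbr_in cl1 y1 pC1 yp nyp.
have sub : N y :&: N y' \subset N p :&: C2.
  by rewrite subsetI sN2 andbT -e1 e2 subsetIr.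
have := subset_leq_card sub.
rewrite muN ?(subsetP s1) //.
have [->|->] := out2 p (subsetP s1 p pC1) pC2; 
  have := leq_mul m_ge3 (leqnn h); linear.
Qed.

(** The common neighbours of y and w off their line lie on two lines that meet
    C, hence in C, for any C through y and w.  There are too many of them for a
    clique, so two of them are nonadjacent, and these determine C. *)
Lemma closed_unique_adj (C1 C2 : {set V}) y w : closed_subset C1 ->
  closed_subset C2 ->
  adj y w -> y \in C1 -> w \in C1 -> y \in C2 -> w \in C2 -> C1 = C2.
Proof.
move=> cl1 cl2 yw y1 w1 y2 w2.
have yNw : y != w by apply: contraTneq yw => ->; rewrite adj_irr.
have [s1 c1 in1 _] := cl1.
have [L [lL yL wL]] := line_exists yw.
pose U := (N y :&: N w) :\: L.
have sU C : closed_subset C -> y \in C -> w \in C -> U \subset C.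
  move=> cl yC wC; apply/subsetP => u.
  rewrite !inE => /andP[uL /andP[yu wu]].
  exact: (off_line_in cl yC wC yNw lL yL wL uL yu wu).
have [/cliqueP cU | /forall_inPn[a aU /forall_inPn[b bU]]] := boolP (clique U).
  have cUyw : clique (y |: (w |: U)).
    have ay u : u \in U -> adj y u by rewrite !inE => /andP[_ /andP[]].
    have aw u : u \in U -> adj w u by rewrite !inE => /andP[_ /andP[]].
    apply/cliqueP => a b; rewrite !in_setU1.
    case/or3P => [/eqP->|/eqP->|aU]; case/or3P => [/eqP->|/eqP->|bU];
      rewrite ?eqxx // => ab; try by [apply: ay | apply: aw | apply: cU].
    - by rewrite adj_sym.
    - by rewrite adj_sym ay.
    - by rewrite adj_sym aw.
  have sub : y |: (w |: U) \subset C1 by rewrite !subUset !sub1set y1 w1 sU.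
  have := clique_in cl1 sub cUyw.
  have -> : #|y |: (w |: U)| = #|U|.+2.
    by rewrite !cardsU1 !inE (negbTE yNw) !adj_irr /= ?andbF ?yL ?wL.
  (* Each of y and w is nonadjacent to m points of C1, itself included. *)
  have lowI : m * h.-1 <= #|N y :&: N w :&: C1|.
    have := cardsUI (N y :&: C1) (N w :&: C1); rewrite !in1 //.
    have -> : N y :&: C1 :&: (N w :&: C1) = N y :&: N w :&: C1.
      by rewrite setIACA setIid.
    have : #|(N y :&: C1) :|: (N w :&: C1)| <= #|C1|.
      by apply: subset_leq_card; rewrite subUset !subsetIr.
    rewrite c1 !mulnS; case: (h) h_ge2 => // h' _; rewrite mulnS /=; linear.
  have split : #|N y :&: N w :&: C1| <= #|U| + h.-1.
    have sub2 : N y :&: N w :&: C1 \subset U :|: (((L :&: C1) :\ y) :\ w).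
      apply/subsetP => z; rewrite !inE => /andP[/andP[yz wz] zC].
      case: (z \in L); rewrite /= ?yz ?wz //=.
      rewrite zC andbT; apply/andP; split.
        by apply: contraTneq wz => ->; rewrite adj_irr.
      by apply: contraTneq yz => ->; rewrite adj_irr.
    apply: leq_trans (subset_leq_card sub2) _.
    apply: leq_trans (leq_card_setU _ _) _; rewrite leq_add2l.
    have := line_meet cl1 lL yL y1.
    rewrite (cardsD1 y) inE yL y1 (cardsD1 w) !inE wL w1 eq_sym yNw /=; linear.
  have : 3 * h.-1 <= m * h.-1 by rewrite leq_mul2r m_ge3 orbT.
  linear.
rewrite negb_imply => /andP[ab nab].
by apply: (closed_unique_nonadj cl1 cl2 ab nab); apply: (subsetP (sU _ _ _ _)).
Qed.

(** Fix adjacent y and w.  Any neighbour v of w that is not adjacent to y lies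
    with y in some C; this C contains w, so it is always the same one, and it
    would contain all the roughly (m - 1) l vertices v. *)
Lemma closed_subsets_contradiction y : y \in Delta ->
    (forall u v, u \in Delta -> v \in Delta -> u != v -> ~~ adj u v ->
       exists C, [/\ closed_subset C, u \in C & v \in C]) ->
  False.
Proof.
move=> yD exC.
have [w yw] : exists w, adj y w.
  have /card_gt0P[w] : 0 < #|N y| by rewrite degN //
    muln_gt0 (leq_trans _ m_ge3) // (leq_trans _ l_large).
  by rewrite inE; exists w.
have wD : w \in Delta by apply: (@adj_in w y); rewrite adj_sym.
pose W := (N w :\: N y) :\ y.
have cW : m * h.+1 < #|W|.
  have := cardsID (N y) (N w); have := lamN yw; rewrite setIC degN //.
  rewrite (cardsD1 y (N w :\: N y)) -/W !inE adj_irr adj_sym yw /=.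
  rewrite mulnS; have : 3 * l <= m * l by rewrite leq_mul2r m_ge3 orbT.
  linear.
have inW v : v \in W -> [/\ v \in Delta, y != v, ~~ adj y v & adj v w].
  rewrite !inE => /and3P[vy yv wv]; split; rewrite // 1?eq_sym // 1?adj_sym //.
  by apply: (@adj_in v w); rewrite adj_sym.
have [v0 v0W] : exists v0, v0 \in W by apply/card_gt0P; apply: leq_trans cW.
have getC v : v \in W ->
    exists C, [/\ closed_subset C, y \in C, v \in C & w \in C].
  move=> vW; have [vD yv nyv vw] := inW v vW.
  have [C [cl yC vC]] := exC y v yD vD yv nyv.
  exists C; split => //; apply: (subsetP (common_in cl yC vC yv nyv)).
  by rewrite !inE yw vw.
have [C0 [cl0 yC0 _ wC0]] := getC v0 v0W.
have : W \subset C0.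
  apply/subsetP => v vW; have [C [cl yC vC wC]] := getC v vW.
  by rewrite (closed_unique_adj cl0 cl yw yC0 wC0 yC wC).
move/subset_leq_card; have [_ -> _ _] := cl0.
by rewrite leqNgt cW.
Qed.

End Lines.

(** * Path-length distance *)

Section Distance.

Variables (T : finType) (e : rel T).
Hypothesis e_conn : connected_graph e.

Let e_sym : symmetric e. Proof. by case: e_conn. Qed.
Let e_irr : irreflexive e. Proof. by case: e_conn. Qed.
Notation d := (gdist e).

(** A path can be shortened to one without repetitions, which has fewer than #|T|
    edges; so the search in the definition of [gdist] succeeds. *)
Lemma gdist_witness x y :
  d x y < #|T| /\ exists p, [/\ path e x p, last x p = y & size p = d x y].
Proof.
have [_ _ /(_ x y)/connectP[p ep ->]] := e_conn.
have [p' ep' up' _] := shortenP ep; set y' := last x p'.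
pose P n := [exists q : n.-tuple T, path e x q && (last x q == y')].
have szp' : size p' < #|T|.
  by have := max_card (mem (x :: p')); rewrite (card_uniqP up').
have hasP : has P (iota 0 #|T|).
  apply/hasP; exists (size p'); first by rewrite mem_iota.
  by apply/existsP; exists (in_tuple p'); rewrite ep' eqxx.
have lt : d x y' < #|T| by have := hasP; rewrite has_find size_iota.
split=> //; have := nth_find 0 hasP.
rewrite nth_iota // add0n /P => /existsP[q /andP[eq /eqP lq]].
by exists q; rewrite size_tuple.
Qed.

Lemma gdist_le x p : path e x p -> d x (last x p) <= size p.
Proof.
move=> ep; rewrite leqNgt; apply/negP => lt.
have [ltT _] := gdist_witness x (last x p).
have := before_find 0 lt; rewrite /= nth_iota ?add0n; last exact: ltn_trans ltT.
by move=> /existsP; apply; exists (in_tuple p); rewrite ep eqxx.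
Qed.

Lemma gdist0P x y : reflect (x = y) (d x y == 0).
Proof.
apply: (iffP eqP) => [d0|->].
  by have [_ [[|z p] [_ /= + +]]] := gdist_witness x y; rewrite d0.
by apply/eqP; rewrite -leqn0 (@gdist_le y [::]).
Qed.

Lemma gdistxx x : d x x = 0. Proof. exact/eqP/gdist0P. Qed.

Lemma gdist1 x y : (d x y == 1) = e x y.
Proof.
apply/eqP/idP => [d1 | exy].
  have [_ [p [ep lp sp]]] := gdist_witness x y.
  move: p sp ep lp; rewrite d1 => -[|z []] //= _ /andP[xz _] <-; exact: xz.
have : d x y <= 1 by rewrite -[y]/(last x [:: y]) gdist_le //= exy.
case E: (d x y) => [|[|n]] // _.
by move/eqP/gdist0P: E exy => ->; rewrite e_irr.
Qed.

Lemma gdist_triangle x y z : d x z <= d x y + d y z.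
Proof.
have [_ [p [ep <- <-]]] := gdist_witness x y.
have [_ [q [eq <- <-]]] := gdist_witness (last x p) z.
by rewrite -last_cat -size_cat gdist_le // cat_path ep.
Qed.

Lemma gdistC x y : d x y = d y x.
Proof.
suff H u v : d v u <= d u v by apply/eqP; rewrite eqn_leq !H.
have [_ [p [ep <- <-]]] := gdist_witness u v.
have := @gdist_le (last u p) (rev (belast u p)).
rewrite rev_path size_rev size_belast.
have -> : last (last u p) (rev (belast u p)) = u.
  by case: p {ep} => //= a p; rewrite rev_cons last_rcons.
by apply; rewrite (eq_path (e' := e)) // => a b; rewrite e_sym.
Qed.

Lemma gdist_nbr x y z : e y z -> d x z <= (d x y).+1.
Proof.
rewrite -gdist1 => /eqP yz.
by have := gdist_triangle x y z; rewrite yz addn1.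
Qed.

Lemma gdist_pred x y i : d x y = i.+1 -> exists2 w, e w y & d x w = i.
Proof.
move=> dxy; have [_ [p [ep lp sp]]] := gdist_witness x y.
case/lastP: p ep lp sp => [|p z]; first by rewrite dxy.
rewrite rcons_path last_rcons size_rcons => /andP[ep ez] zy sp.
rewrite zy in ez; exists (last x p) => //.
apply/eqP; rewrite eqn_leq; apply/andP; split.
  by rewrite (leq_trans (gdist_le ep)) // -ltnS sp dxy.
by have := gdist_nbr x ez; rewrite dxy.
Qed.

Lemma gdist_diameter x y : d x y <= diameter e.
Proof.
apply: leq_trans (leq_bigmax x).
exact: (leq_bigmax (F := fun y => d x y)).
Qed.

Lemma exists_gdist i : 0 < diameter e -> i <= diameter e ->
  exists x y, d x y = i.
Proof.
move=> D0; have : exists x y, d x y = diameter e.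
  have T0 : 0 < #|T|.
    rewrite lt0n; apply/eqP => T0; move: D0;
      rewrite /diameter big_pred0 // => x.
    by have := card0_eq T0 x.
  have [x Ex] := @bigop.eq_bigmax T (fun x => \max_(y : T) d x y) T0.
  have [y Ey] := @bigop.eq_bigmax T (fun y => d x y) T0.
  by exists x, y; rewrite -Ey -Ex.
case=> x [y <-].
move: {2}(_ - _) (erefl (d x y - i)) => n.
elim: n y => [|n IH] z dz iz.
  by exists x, z; apply/eqP; rewrite eqn_leq iz -subn_eq0 dz.
have [w _ dw] : exists2 w, e w z & d x w = (d x z).-1.
  by apply: gdist_pred; lia.
by apply: (IH w); rewrite dw; lia.
Qed.

End Distance.

(** * Intersection numbers as cardinalities *)

Section Counting.

Variables (T : finType) (e : rel T).
Hypothesis e_dr : distance_regular e.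
Hypothesis D_gt0 : 0 < diameter e.
Let e_conn : connected_graph e. Proof. by case: e_dr. Qed.
Notation d := (gdist e).
Notation D := (diameter e).

Lemma pnumE h i j x y : h <= D -> i <= D -> j <= D -> d x y = h ->
  #|sphere e i x :&: sphere e j y| = pnum e h i j.
Proof.
move=> hD iD jD dxy; rewrite /pnum; case: pickP => [u /eqP du | no].
  by case: e_dr => _ /(_ h i j hD iD jD); apply.
by have := no (x, y); rewrite /= dxy eqxx.
Qed.

Lemma card_nbr y : #|[set w | e y w]| = bnum e 0.
Proof.
rewrite /bnum -(@pnumE 0 1 1 y y) ?gdistxx // setIid.
by apply: eq_card => w; rewrite !inE gdist1.
Qed.

Lemma card_nbr_closer x y i : d x y = i.+1 ->
  #|[set w | e y w & d x w == i]| = cnum e i.+1.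
Proof.
move=> dxy; have iD : i < D by rewrite -dxy gdist_diameter.
rewrite /cnum -(@pnumE i.+1 1 i y x) //; last by rewrite gdistC.
- by apply: eq_card => w; rewrite !inE gdist1.
- exact: ltnW.
Qed.

Lemma card_nbr_farther x y i : d x y = i -> i < D ->
  #|[set w | e y w & d x w == i.+1]| = bnum e i.
Proof.
move=> dxy iD; rewrite /bnum -(@pnumE i 1 i.+1 y x) //; last by rewrite gdistC.
- by apply: eq_card => w; rewrite !inE gdist1.
- exact: ltnW.
Qed.

Lemma card_common_nbr x y : e x y -> #|[set w | e x w & e y w]| = anum e 1.
Proof.
move=> xy; rewrite /anum -(@pnumE 1 1 1 x y) //.
  by apply: eq_card => w; rewrite !inE !gdist1.
by apply/eqP; rewrite gdist1.
Qed.

Lemma bnum_gt0 i : i < D -> 0 < bnum e i.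
Proof.
move=> iD; have [x [y dxy]] := exists_gdist e_conn D_gt0 iD.
have [w wy dxw] := gdist_pred e_conn dxy.
rewrite -(card_nbr_farther dxw iD); apply/card_gt0P; exists y.
by rewrite inE wy dxy eqxx.
Qed.

Lemma cnum_gt0 i : 0 < i <= D -> 0 < cnum e i.
Proof.
case: i => // i /= iD; have [x [y dxy]] := exists_gdist e_conn D_gt0 iD.
have [w wy dxw] := gdist_pred e_conn dxy.
rewrite -(card_nbr_closer dxy); apply/card_gt0P; exists w.
by have [es _ _] := e_conn; rewrite inE es wy dxw eqxx.
Qed.

End Counting.

Local Open Scope ring_scope.

(** * Gram matrices and ranks *)

Lemma sum_indicator (R : pzRingType) (T : finType) (P Q : pred T) :
  \sum_(w | P w) (Q w)%:R = #|[set w | P w & Q w]|%:R :> R.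
Proof.
rewrite -sum1_card natr_sum big_mkcond [RHS]big_mkcond /=.
by apply: eq_bigr => w _; rewrite inE; case: (P w); case: (Q w).
Qed.

(** This is the fact that two positive semidefinite matrices whose product has
    trace 0 have product 0: for g = p^T p and g' = p'^T p' the trace of g g' is the
    sum of the squares of the entries of p p'^T. *)
Lemma psd_product_eq0 (R : realDomainType) (T : finType) (P : pred T)
    (p p' g g' : T -> T -> R) :
    (forall y z, P y -> P z -> g y z = \sum_w p w y * p w z) ->
    (forall y z, P y -> P z -> g' y z = \sum_w p' w y * p' w z) ->
    \sum_(y | P y) \sum_(z | P z) g y z * g' z y = 0 ->
  forall u v, P u -> P v -> \sum_(y | P y) g u y * g' y v = 0.
Proof.
move=> gE g'E tr0 u v Pu Pv.
pose Z w w' := \sum_(y | P y) p w y * p' w' y.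
have ggE y z x : P y -> P z -> P x -> g y z * g' z x =
    \sum_w \sum_w' p w y * p' w' x * (p w z * p' w' z).
  move=> Py Pz Px; rewrite gE // g'E // mulr_suml; apply: eq_bigr => w _.
  by rewrite mulr_sumr; apply: eq_bigr => w' _; ring.
have rowE y x : P y -> P x -> \sum_(z | P z) g y z * g' z x =
    \sum_w \sum_w' p w y * p' w' x * Z w w'.
  move=> Py Px; under eq_bigr => z Pz do rewrite ggE //.
  rewrite exchange_big /=; apply: eq_bigr => w _.
  rewrite exchange_big /=; apply: eq_bigr => w' _.
  by rewrite -mulr_sumr.
have Z2 : \sum_w \sum_w' Z w w' ^+ 2 = 0.
  rewrite -[RHS]tr0; under [RHS]eq_bigr => y Py do rewrite rowE //.
  rewrite [RHS]exchange_big /=; apply: eq_bigr => w _.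
  rewrite [RHS]exchange_big /=; apply: eq_bigr => w' _.
  by rewrite -mulr_suml expr2.
have Z0 w w' : Z w w' = 0.
  have n1 w1 : 0 <= \sum_w' Z w1 w' ^+ 2 by apply: sumr_ge0 => *;
    apply: sqr_ge0.
  have /eqP := Z2; rewrite psumr_eq0 // => /allP/(_ w (mem_index_enum _))/=.
  rewrite psumr_eq0 => [|w1 _]; last exact: sqr_ge0.
  by move=> /allP/(_ w' (mem_index_enum _))/=; rewrite sqrf_eq0 => /eqP.
rewrite rowE //; apply: big1 => w _; apply: big1 => w' _.
by rewrite Z0 mulr0.
Qed.

(** The trace of an idempotent matrix is its rank. *)
Lemma idempotent_factor (R : fieldType) (T : finType) (p : T -> T -> R) :
    (forall y z, \sum_w p y w * p w z = p y z) ->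
  exists f (u v : 'I_f -> T -> R),
    (forall y z, p y z = \sum_i u i y * v i z) /\ \sum_y p y y = f%:R.
Proof.
move=> pp.
pose P : 'M[R]_#|T| := \matrix_(i, j) p (enum_val i) (enum_val j).
have PP : P *m P = P.
  apply/matrixP => i j; rewrite !mxE -[RHS]pp [RHS](reindex (fun l : 'I_#|T| =>
    enum_val l)) /=.
    by apply: eq_bigr => l _; rewrite !mxE.
  by apply: onW_bij; apply: enum_val_bij.
have BB : row_base P *m col_base P = 1%:M.
  have [C CB] := row_fullP (col_base_full P).
  have [B BC] := row_freeP (row_base_free P).
  move: (col_base P) (row_base P) (mulmx_base P) C CB B BC.
  move=> cb rb cbrb C CB B BC.
  have -> : rb *m cb = C *m (cb *m rb) *m (cb *m rb) *m B.
    by rewrite !mulmxA CB mul1mx -!mulmxA BC mulmx1.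
  rewrite cbrb -[C *m P *m P]mulmxA PP.
  have -> : C *m P *m B = C *m cb *m (rb *m B).
    by rewrite mulmxA -(mulmxA C cb) cbrb.
  by rewrite CB BC mul1mx.
exists (\rank P), (fun i y => col_base P (enum_rank y) i),
  (fun i y => row_base P i (enum_rank y)); split=> [y z|].
  have -> : p y z = P (enum_rank y) (enum_rank z) by rewrite mxE !enum_rankK.
  by rewrite -{1}(mulmx_base P) mxE.
have -> : \sum_y p y y = \tr P.
  rewrite /mxtrace (reindex (fun l : 'I_#|T| => enum_val l)) /=;
    last by apply: onW_bij; apply: enum_val_bij.
  by apply: eq_bigr => i _; rewrite mxE.
by rewrite -{1}(mulmx_base P) mxtrace_mulC BB mxtrace1.
Qed.

Lemma card_le_factor (R : comUnitRingType) (T I : finType) (A : {set T})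
    (u v : I -> T -> R) :
    (forall y z, y \in A -> z \in A -> \sum_i u i y * v i z = (y == z)%:R) ->
  (#|A| <= #|I|)%N.
Proof.
move=> uv.
pose M : 'M[R]_(#|A|, #|I|) := \matrix_(a, i) u (enum_val i) (enum_val a).
pose N : 'M[R]_(#|I|, #|A|) := \matrix_(i, a) v (enum_val i) (enum_val a).
apply: (@mulmx1_min _ _ _ M N); apply/matrixP => a a'.
rewrite !mxE -(inj_eq enum_val_inj) -uv ?enum_valP //
  [RHS](reindex (fun l : 'I_#|I| => enum_val l)) /=.
  by apply: eq_bigr => l _; rewrite !mxE.
by apply: onW_bij; apply: enum_val_bij.
Qed.

(** The entries of the matrix uv on A take the two values a and a' off the
    diagonal, so the entrywise product of uv - a and uv - a' is a multiple of the
    identity; each factor has rank at most f + 1. *)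
Lemma two_distance_bound (R : fieldType) (T : finType) (A : {set T}) (f : nat)
    (u v : 'I_f -> T -> R) (a a' c : R) : c != 0 ->
    (forall y z, y \in A -> z \in A ->
       (\sum_i u i y * v i z - a) * (\sum_i u i y * v i z - a') =
       c * (y == z)%:R) ->
  (#|A| <= f.+1 * f.+1)%N.
Proof.
move=> c0 uv; rewrite -[f.+1]card_ord -card_prod.
(* The additional coordinate subtracts the constant a, respectively a'. *)
pose U (i : 'I_f.+1) y := oapp (u^~ y) 1 (unlift ord0 i).
pose V a (i : 'I_f.+1) y := oapp (v^~ y) (- a) (unlift ord0 i).
have UV a0 y z : \sum_i U i y * V a0 i z = \sum_i u i y * v i z - a0.
  rewrite big_ord_recl /U /V unlift_none /= mul1r addrC; congr (_ + _).
  by apply: eq_bigr => i _; rewrite liftK.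
apply: (@card_le_factor R _ _ A (fun ij y => c^-1 * (U ij.1 y * U ij.2 y))
  (fun ij z => V a ij.1 z * V a' ij.2 z)) => y z yA zA.
rewrite -(pair_bigA _ (fun i j => c^-1 * (U i y * U j y) * (V a i z * V a' j
  z))) /=.
have -> : (y == z)%:R = c^-1 * (c * (y == z)%:R) by rewrite mulKf.
rewrite -uv // -!UV big_distrlr mulr_sumr /=.
apply: eq_bigr => i _; rewrite mulr_sumr; apply: eq_bigr => j _; ring.
Qed.

(** * Arithmetic of the multiplicity *)

(** The first equation gives f <= 2 m p n, so the valency, of order
    p t n^2 / m, is at most of order (m p n)^2. *)
Lemma multiplicity_bound (p n t f : nat) : (0 < p)%N -> (1 < n)%N ->
  (0 < t)%N ->
    (f * (t * n.-1 + p.+1 * p.+1) = n * p.+1 * p * (p.+1 + t * n))%N ->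
    ((1 + p * n) * (p.+1 + t * n) <= p.+1 * (f.+1 * f.+1))%N ->
  (t <= 9 * (p.+1 * p.+1 * p.+1 * p))%N.
Proof.
case: n => // y; rewrite ltnS /= => p_gt0 y_gt0 t_gt0 fE kE.
set m := p.+1 in fE kE *; set n := y.+1 in fE kE *.
have m_le : (m <= m * m)%N by rewrite leq_pmulr.
have t_le : (t <= t * y)%N by rewrite leq_pmulr.
have N_gt0 : (0 < t * y + m * m)%N by rewrite addn_gt0 muln_gt0 t_gt0 y_gt0.
have f_le : (f <= 2 * (m * p * n))%N.
  rewrite -(leq_pmul2r N_gt0) fE.
  have -> : (n * m * p * (m + t * n) = m * p * n * (m + t * n))%N by ring.
  rewrite [(2 * _)%N]mulnC -[X in (_ <= X)%N]mulnA leq_mul2l.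
  by apply/orP; right; rewrite /n mulnS; lia.
have mpn_gt0 : (0 < m * p * n)%N by rewrite !muln_gt0 p_gt0.
have f1_le : (f.+1 <= 3 * (m * p * n))%N by lia.
have pn_gt0 : (0 < p * n * n)%N by rewrite !muln_gt0 p_gt0.
rewrite -(leq_pmul2r pn_gt0).
apply: leq_trans (_ : (1 + p * n) * (m + t * n) <= _)%N.
  have -> : (t * (p * n * n) = p * n * (t * n))%N by ring.
  by apply: leq_mul; [apply: leq_addl | apply: leq_addl].
apply: leq_trans kE _.
have -> : (9 * (m * m * m * p) * (p * n * n) =
  m * (3 * (m * p * n) * (3 * (m * p * n))))%N.
  by ring.
by rewrite leq_mul2l leq_mul // orbT.
Qed.

(** Modulo N = t (n - 1) + m^2 one has t n = t - m^2; multiplying the equation by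
    t therefore shows that N divides m p (t - m^2) (t - m p). *)
Lemma multiplicity_dvd (p n t f : nat) : (0 < n)%N -> (0 < t)%N ->
    (f * (t * n.-1 + p.+1 * p.+1) = n * p.+1 * p * (p.+1 + t * n))%N ->
    t != (p.+1 * p)%N -> t != (p.+1 * p.+1)%N -> (0 < p)%N ->
  (n <= p.+1 * p * ((t + p.+1 * p.+1) * (t + p.+1 * p.+1)))%N.
Proof.
case: n => // y _ t_gt0 fE tn1 tn2 p_gt0; rewrite /= in fE.
pose m := p.+1; pose N := (t * y + m * m)%N.
pose a : int := t%:Z - (m * m)%N%:Z.
have a_eq : a + m%:Z = t%:Z - (m * p)%N%:Z.
  by rewrite /a /m mulSn mulnC !PoszD; ring.
pose c : int := (m * p)%N%:Z * (a * (a + m%:Z)).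
pose s : int := t%:Z * f%:Z - (m * p)%N%:Z * (N%:Z + a + a + m%:Z).
have Ns : N%:Z * s = c.
  have fN : f%:Z * N%:Z = (y.+1 * m * p * (m + t * y.+1))%N%:Z.
    by rewrite -PoszM fE.
  have -> : N%:Z * s = t%:Z * (f%:Z * N%:Z)
      - (m * p)%N%:Z * (N%:Z + a + a + m%:Z) * N%:Z by rewrite /s; ring.
  rewrite fN /c /N /a !(PoszM, PoszD) -[y.+1]addn1 PoszD; ring.
have c_neq0 : c != 0.
  rewrite /c a_eq; apply: mulf_neq0; first by rewrite eqz_nat -lt0n muln_gt0.
  by apply: mulf_neq0; rewrite subr_eq0 eqz_nat.
have N_le : (N <= `|c|)%N.
  rewrite -Ns abszM leq_pmulr // absz_gt0.
  by apply: contraNneq c_neq0 => s0; rewrite -Ns s0 mulr0.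
have n_le : (y.+1 <= N)%N.
  rewrite /N -addn1; apply: leq_add; last by rewrite muln_gt0.
  by rewrite leq_pmull.
apply: leq_trans n_le (leq_trans N_le _).
rewrite /c a_eq !abszM; apply: leq_mul => //; apply: leq_mul.
  by rewrite /a -/m; lia.
have : (m * p <= m * m)%N by rewrite leq_mul2l leqnSn orbT.
rewrite -/m; lia.
Qed.

(** * Tight graphs with classical parameters *)

Definition diameter_bound (p : nat) :=
  (let m := p.+1 in let s := 9 * (m * m * m * p) + m * m in
  (m * p * (s * s) + 9 * (m * (m * m))).+1)%N.

Section Classical.

Variables (R : realType) (T : finType) (e : rel T).
Variables (b : int) (alpha beta : R).
Notation D := (diameter e).
Hypothesis e_classical : classical_parameters e D b alpha beta.
Hypothesis b_ge2 : (2 <= b)%R.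
Notation d := (gdist e).

Let e_dr : distance_regular e. Proof. by case: e_classical. Qed.
Let e_conn : connected_graph e. Proof. by case: e_dr. Qed.
Let D_ge3 : (3 <= D)%N. Proof. by case: e_classical. Qed.
Let D_gt0 : (0 < D)%N. Proof. exact: leq_trans D_ge3. Qed.

Let q : R := b%:~R.
Let br (i : nat) : R := gauss1 R b i.

(** The classical formulas for c_i, b_i and a_i.  They give c_0 = 0 and b_D = 0,
    so the end points need no special treatment. *)
Definition cpar i := br i * (1 + alpha * br i.-1).
Definition bpar i := (br D - br i) * (beta - alpha * br i).
Definition apar i := bpar 0 - bpar i - cpar i.

Lemma q_ge2 : 2 <= q.
Proof. by rewrite -[2]/(2%:~R) ler_int. Qed.

Lemma q_neq0 : q != 0. Proof. by have := q_ge2; lra. Qed.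
Lemma q1_neq0 : q - 1 != 0. Proof. by have := q_ge2; lra. Qed.

Lemma br0 : br 0 = 0. Proof. by rewrite /br /gauss1 big_ord0. Qed.
Lemma brS i : br i.+1 = br i + q ^+ i.
Proof. by rewrite /br /gauss1 big_ord_recr. Qed.
Lemma br1 : br 1 = 1. Proof. by rewrite brS br0 add0r. Qed.
Lemma brE i : br i = (q ^+ i - 1) / (q - 1).
Proof.
elim: i => [|i IH]; first by rewrite br0 subrr mul0r.
by rewrite brS IH exprS; field; apply: q1_neq0.
Qed.
Lemma brSl i : br i.+1 = 1 + q * br i.
Proof. by rewrite !brE exprS; field; apply: q1_neq0. Qed.
Lemma qX_gt0 i : 0 < q ^+ i.
Proof. by apply: exprn_gt0; have := q_ge2; lra. Qed.
Lemma br_ge i : i%:R <= br i.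
Proof.
elim: i => [|i IH]; first by rewrite br0.
rewrite brS -natr1 lerD // exprn_ege1 //; by have := q_ge2; lra.
Qed.
Lemma br_lt i j : (i < j)%N -> br i < br j.
Proof.
elim: j => // j IH; rewrite ltnS leq_eqVlt => /orP[/eqP->|/IH lt].
  by rewrite brS ltrDl qX_gt0.
by apply: lt_trans lt _; rewrite brS ltrDl qX_gt0.
Qed.

Lemma cnumE i : (0 < i <= D)%N -> (cnum e i)%:R = cpar i.
Proof. by case: e_classical => _ _ _ _ [_ H]; apply: H. Qed.

Lemma bnumE i : (i < D)%N -> (bnum e i)%:R = bpar i.
Proof.
case: e_classical => _ _ _ _ [H _] iD; apply: H.
by rewrite -ltnS prednK.
Qed.

Lemma bpar_gt0 i : (i < D)%N -> 0 < bpar i.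
Proof. by move=> iD; rewrite -bnumE // ltr0n bnum_gt0. Qed.

Lemma cpar_gt0 i : (0 < i <= D)%N -> 0 < cpar i.
Proof. by move=> iD; rewrite -cnumE // ltr0n cnum_gt0. Qed.

Lemma cpar0 : cpar 0 = 0. Proof. by rewrite /cpar br0 mul0r. Qed.
Lemma bparD : bpar D = 0. Proof. by rewrite /bpar subrr mul0r. Qed.
Lemma cpar1 : cpar 1 = 1. Proof. by rewrite /cpar br1 /= br0; ring. Qed.

(** Summation over the neighbours of y acts on a function of the distance to x as
    a tridiagonal matrix.  The regularity of the graph enters what follows mostly
    through this formula. *)
Lemma nbr_sum (f : nat -> R) x y i : d x y = i ->
  \sum_(w | e y w) f (d x w) = cpar i * f i.-1 + apar i * f i + bpar i * f i.+1.
Proof.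
move=> dxy; have iD : (i <= D)%N by rewrite -dxy gdist_diameter.
have step w : e y w -> f (d x w) = f i + (d x w == i.+1)%:R * (f i.+1 - f i)
    + ((d x w).+1 == i)%:R * (f i.-1 - f i).
  move=> yw; have := gdist_nbr e_conn x yw.
  have es : symmetric e by case: e_conn.
  rewrite es in yw; have := gdist_nbr e_conn x yw; rewrite dxy => le1 le2.
  have [E|[E|E]] : d x w = i.+1 \/ d x w = i \/ (d x w).+1 = i by lia.
  - by rewrite E eqxx [i.+2 == i]eqn_leq ltnNge leqnSn /=; ring.
  - by rewrite E [i == i.+1]eqn_leq [i.+1 == i]eqn_leq ltnn andbF /=; ring.
  - rewrite E -E eqxx eqn_leq /= [(_.+2 <= _)%N]ltnNge leqnSn andbF /=; ring.
rewrite (eq_bigr _ step) !big_split /= -!mulr_suml !sum_indicator.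
have -> : \sum_(w | e y w) f i = bpar 0 * f i.
  rewrite -bnumE // -(card_nbr e_dr D_gt0 y) -sum1_card natr_sum mulr_suml.
  by apply: eq_big => w; rewrite ?inE // mul1r.
have -> : #|[set w | e y w & d x w == i.+1]|%:R = bpar i.
  have [iltD | Dlei] := ltnP i D; first by rewrite -bnumE //
    (card_nbr_farther e_dr).
  have -> : i = D by apply/eqP; rewrite eqn_leq iD.
  rewrite bparD; apply/eqP; rewrite pnatr_eq0 cards_eq0; apply/eqP/setP => w.
  rewrite !inE; apply/negP => /andP[_ /eqP dw].
  by have := gdist_diameter e x w; rewrite dw ltnn.
have -> : #|[set w | e y w & (d x w).+1 == i]|%:R = cpar i.
  case: i dxy iD {step} => [|i] dxy iD.
    by rewrite cpar0; apply/eqP; rewrite pnatr_eq0 cards_eq0;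
      apply/eqP/setP => w;
       rewrite !inE andbF.
  by rewrite -cnumE // -(card_nbr_closer e_dr D_gt0 dxy); congr (_%:R);
    apply: eq_card => w; rewrite !inE eqSS.
by rewrite /apar; ring.
Qed.

(** ** The spectrum *)

(** The eigenvalues of a graph with classical parameters, in their natural
    order. *)
Definition theta i := (br (D - i)) * (beta - alpha * br i) - br i.

(** The functions [tau h], products of h linear factors in q^-i, make [radial]
    triangular; q^-i is, up to an affine change, the dual eigenvalue of index i. *)
Definition tau h i : R := \prod_(l < h) (q^-1 ^+ i - q^-1 ^+ l).

Definition phi h := bpar h.-1 * q^-1 ^+ h * (q^-1 ^+ h.-1 - q).

Definition radial (f : nat -> R) i := cpar i * f i.-1 + apar i * f i + bpar i *
  f i.+1.

Lemma tauS h i : tau h.+1 i = tau h i * (q^-1 ^+ i - q^-1 ^+ h).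
Proof. by rewrite /tau big_ord_recr. Qed.

Lemma tau_below h i : (i < h)%N -> tau h i = 0.
Proof.
by move=> ih; rewrite /tau (bigD1 (Ordinal ih)) //= subrr mul0r.
Qed.

Lemma tau_diag h : tau h h != 0.
Proof.
apply/prodf_neq0 => l _; rewrite subr_eq0.
have q01 : 0 < q^-1 < 1 by rewrite invr_gt0 invf_lt1; have := q_ge2; lra.
by rewrite lt_eqF // ltr_iXn2l //; case/andP: q01.
Qed.

Lemma tau_up h i : tau h.+1 i.+1 = q^-1 ^+ h.+1 * (q^-1 ^+ i - q) * tau h i.
Proof.
elim: h => [|h IH].
  rewrite tauS /tau !big_ord0 expr0 expr1 mul1r mulr1 exprS mulrBr mulVf //.
  exact: q_neq0.
rewrite tauS IH tauS; move: (tau h i) => t; rewrite !exprS.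
by field; apply: q_neq0.
Qed.

Lemma tau_down h i :
  (q^-1 ^+ i.+1 - 1) * tau h.+1 i =
  q ^+ h.+1 * tau h i.+1 * (q^-1 ^+ i.+1 - q^-1 ^+ h) * (q^-1 ^+ i.+1 - q^-1 ^+
    h.+1).
Proof.
elim: h => [|h IH].
  rewrite tauS /tau !big_ord0 expr0 !expr1 mul1r mulr1 exprS.
  by field; apply: q_neq0.
rewrite tauS mulrA IH tauS; move: (tau h i.+1) => t; rewrite !exprS.
by field; apply: q_neq0.
Qed.

Lemma radial_tau0 i : radial (tau 0) i = theta 0 * tau 0 i.
Proof.
rewrite /radial /apar /theta subn0 /bpar /tau !big_ord0 br0; ring.
Qed.

Lemma radial_tau h i : (h < D)%N -> (i <= D)%N ->
  radial (tau h.+1) i = theta h.+1 * tau h.+1 i + phi h.+1 * tau h i.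
Proof.
move=> hD iD; rewrite /radial tau_up /phi /=.
have qn := q_neq0; have q1n := q1_neq0.
have qDE : br (D - h.+1) = (q ^+ D * q^-1 ^+ h.+1 - 1) / (q - 1).
  by rewrite brE -{2}(subnK hD) exprD -mulrA -exprMn divff // expr1n mulr1.
have XhN : q ^+ h != 0 by rewrite expf_neq0.
have XiN : q ^+ i != 0 by rewrite expf_neq0.
case: i iD XiN => [|i] iD XiN.
  have tau0 k : tau k.+1 0 = 0.
    by rewrite /tau big_ord_recl /= expr0 subrr mul0r.
  rewrite cpar0 tau0 mul0r !mulr0 !add0r; case: h {hD qDE XhN} => [|h].
    by rewrite /tau big_ord0; ring.
  by rewrite tau0 !mulr0.
have -> : cpar i.+1 * tau h.+1 i.+1.-1 =
    (1 + alpha * br i) * (- q ^+ i.+1 / (q - 1)) *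
    ((q^-1 ^+ i.+1 - 1) * tau h.+1 i).
  rewrite /cpar /= brE exprVn; move: (tau h.+1 i) => t.
  by field; rewrite q1n XiN.
rewrite tau_down /theta qDE tauS; move: (tau h i.+1) => t.
rewrite /apar /bpar /cpar br0 !brE !exprVn !exprS /=.
have Yn : q ^+ i != 0 by rewrite expf_neq0.
move: XhN Yn {XiN qDE}; move: (q ^+ h) (q ^+ D) (q ^+ i) => H X Y XhN Yn.
by field; rewrite XhN qn q1n Yn.
Qed.



Lemma phi_neq0 h : (h < D)%N -> phi h.+1 != 0.
Proof.
move=> hD; rewrite /phi /=; apply: mulf_neq0.
  apply: mulf_neq0; first by rewrite lt0r_neq0 // bpar_gt0.
  by rewrite expf_neq0 // invr_eq0 q_neq0.
have : q^-1 ^+ h <= 1.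
  rewrite exprn_ile1 ?invr_ge0 ?invf_le1; have := q_ge2; lra.
by have := q_ge2; lra.
Qed.

(** The difference is a sum of two terms which are positive because b_i > 0 and
    c_(D-i) > 0. *)
Lemma theta_decr i : (i < D)%N -> theta i.+1 < theta i.
Proof.
move=> iD; rewrite -subr_gt0.
have Di : (D - i = (D - i.+1).+1)%N by lia.
have -> : theta i - theta i.+1 = q ^+ (D - i.+1) * (beta - alpha * br i)
    + q ^+ i * (1 + alpha * br (D - i.+1)).
  by rewrite /theta Di !brS; ring.
apply: addr_gt0; apply: mulr_gt0 (qX_gt0 _) _.
  have := bpar_gt0 iD; rewrite /bpar pmulr_rgt0 // subr_gt0.
  exact: br_lt.
have : 0 < cpar (D - i.+1).+1 by apply: cpar_gt0; lia.
by rewrite /cpar pmulr_rgt0 // (le_lt_trans (ler0n _ 0)) //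
  (lt_le_trans _ (br_ge _)) // ltr0n.
Qed.

Lemma theta_lt i j : (i < j <= D)%N -> theta j < theta i.
Proof.
elim: j => // j IH /andP[]; rewrite ltnS leq_eqVlt => /orP[/eqP->|lt] jD.
  exact: theta_decr.
by apply: lt_trans (IH _); rewrite ?lt ?(ltnW jD) // theta_decr.
Qed.

(** A combination of tau 0, .., tau j whose coefficients solve the triangular
    system; phi does not vanish, so tau 0 can be given coefficient 1. *)
Lemma eigenfunction j : (j <= D)%N -> exists f : nat -> R,
  f 0 = 1 /\ forall i, (i <= D)%N -> radial f i = theta j * f i.
Proof.
move=> jD.
pose c k := \prod_(l < k) ((theta j - theta l) / phi l.+1).
pose F k i := \sum_(h < k) c h * tau h i.
have FS k i : F k.+1 i = F k i + c k * tau k i by rewrite /F big_ord_recr.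
have LFS k i : radial (F k.+1) i = radial (F k) i + c k * radial (tau k) i.
  by rewrite /radial !FS; ring.
have key k i : (k <= D)%N -> (i <= D)%N ->
    radial (F k.+1) i - theta j * F k.+1 i =
      (theta k - theta j) * c k * tau k i.
  elim: k => [_ _ | k IH kD iD].
    rewrite LFS FS radial_tau0 /radial /F !big_ord0; ring.
  have E : c k.+1 * phi k.+1 = (theta j - theta k) * c k.
    by rewrite /c big_ord_recr /= -/(c k) -mulrA divfK ?phi_neq0 // mulrC.
  rewrite LFS FS radial_tau // mulrDr (mulrA (c k.+1) (phi _)) E.
  by have := IH (ltnW kD) iD; rewrite -/(F k.+1) => /eqP;
    rewrite subr_eq => /eqP ->; ring.
exists (F j.+1); split=> [|i iD].
  rewrite /F big_ord_recl /= big1 ?addr0;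
    first by rewrite /c /tau !big_ord0 mul1r.
  by move=> h _; rewrite tau_below ?mulr0.
by have /eqP := key j i jD iD; rewrite subrr !mul0r subr_eq0 => /eqP.
Qed.

Lemma eigenvalue_adjP (a : R) : reflect
  (exists v : T -> R, (exists y, v y != 0) /\
     forall y, \sum_(w | e y w) v w = a * v y)
  (eigenvalue (adjmx R e) a).
Proof.
have es : symmetric e by case: e_conn.
have mulE (u : 'rV[R]_#|T|) (y : T) : (u *m adjmx R e) 0 (enum_rank y) =
    \sum_(w | e y w) u 0 (enum_rank w).
  rewrite mxE (reindex_onto enum_rank enum_val) /=; last first.
    by move=> i _; rewrite enum_valK.
  rewrite [RHS]big_mkcond; apply: eq_big => [w|w _].
    by rewrite enum_rankK eqxx.
  by rewrite mxE !enum_rankK es; case: (e y w); rewrite ?mulr1 ?mulr0.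
apply: (iffP eigenvalueP) => [[u uA u0]|[v [[y vy] vA]]].
  exists (fun y => u 0 (enum_rank y)); split.
    have /rV0Pn[i ui] := u0.
    by exists (enum_val i); rewrite enum_valK.
  by move=> y; rewrite -mulE uA mxE.
exists (\row_i v (enum_val i)).
  apply/rowP => i; rewrite -[i]enum_valK mulE !mxE enum_rankK -vA.
  by apply: eq_bigr => w _; rewrite mxE enum_rankK.
by apply/rV0Pn; exists (enum_rank y); rewrite mxE enum_rankK.
Qed.

(** Each theta_j is an eigenvalue by [eigenfunction].  Conversely, if v is an
    eigenvector for another value a, then the sums S f of f(d(x,y)) v(y) satisfy
    S(radial f) = a S f, so they vanish on the basis tau, hence on the indicator
    of distance 0, and v(x) = 0. *)
Lemma spectrumE (a : R) :
  eigenvalue (adjmx R e) a = (a \in mkseq theta D.+1).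
Proof.
apply/eigenvalue_adjP/idP => [[v [[x vx] vA]]|]; last first.
  case/mapP => j; rewrite mem_iota add0n ltnS => /= jD ->.
  have [f [f0 fL]] := eigenfunction jD.
  have [x _] := exists_gdist e_conn D_gt0 (leq0n D).
  exists (fun y => f (d x y)); split; first by exists x;
    rewrite gdistxx // f0 oner_neq0.
  by move=> y; rewrite (nbr_sum _ (erefl (d x y))) -/(radial f _) fL //
    gdist_diameter.
apply: contraT => anot.
have an h : (h <= D)%N -> a - theta h != 0.
  move=> hD; rewrite subr_eq0; apply: contraNneq anot => ->.
  by apply/mapP; exists h; rewrite // mem_iota ltnS.
pose S f := \sum_y f (d x y) * v y.
have es : symmetric e by case: e_conn.
have SL f : S (radial f) = a * S f.
  rewrite /S mulr_sumr.
  under [RHS]eq_bigr => y _.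
    rewrite mulrCA -vA mulr_sumr; over.
  rewrite (exchange_big_dep predT) //=; apply: eq_bigr => w _.
  rewrite -mulr_suml /radial -(nbr_sum _ (erefl (d x w))); congr (_ * _).
  by apply: eq_bigl => y; rewrite es.
have S0 h : (h <= D)%N -> S (tau h) = 0.
  elim: h => [_ | h IH hD].
    have := SL (tau 0); rewrite /S.
    under eq_bigr => y _ do rewrite radial_tau0 -mulrA.
    rewrite -mulr_sumr -/(S _) => /eqP.
    rewrite eq_sym -subr_eq0 -mulrBl mulf_eq0 (negbTE (an 0 _)) //=.
    by move/eqP.
  have := SL (tau h.+1); rewrite /S.
  under eq_bigr => y _ do
    rewrite radial_tau ?gdist_diameter // mulrDl
      -[theta _ * _ * _]mulrA -[phi _ * _ * _]mulrA.
  rewrite big_split /= -!mulr_sumr -!/(S _) IH 1?ltnW // mulr0 addr0 => /eqP.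
  rewrite eq_sym -subr_eq0 -mulrBl mulf_eq0 (negbTE (an _ hD)) /=.
  by move/eqP.
pose lvl i := \sum_(y | d x y == i) v y.
have SE f : S f = \sum_(i < D.+1) f i * lvl i.
  rewrite /S (partition_big (fun y => inord (d x y) : 'I_D.+1) predT) //=.
  apply: eq_bigr => i _; rewrite /lvl mulr_sumr.
  have inordE y : (inord (d x y) == i) = (d x y == i).
    by rewrite -val_eqE /= inordK // ltnS gdist_diameter.
  by apply: eq_big => [y|y] /[!inordE] // /eqP ->.
have lvl0 n : (n <= D)%N -> lvl (D - n)%N = 0.
  elim/ltn_ind: n => n IH nD.
  have kD : (D - n < D.+1)%N by rewrite ltnS leq_subr.
  have := S0 _ (leq_subr n D).
  rewrite SE (bigD1 (Ordinal kD)) //= big1 ?addr0.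
    by move/eqP; rewrite mulf_eq0 (negbTE (tau_diag _)) => /eqP.
  move=> i; rewrite -val_eqE /= => ik.
  have [lt | ge] := ltnP i (D - n).
    by rewrite tau_below // mul0r.
  have iD : (i <= D)%N by rewrite -ltnS.
  rewrite -(subKn iD) [lvl _]IH ?mulr0 ?leq_subr //.
  have : (D - n < i)%N by rewrite ltn_neqAle eq_sym ik.
  lia.
have := lvl0 D (leqnn D); rewrite subnn /lvl (big_pred1 x).
  by move=> v0; rewrite v0 eqxx in vx.
by move=> y; rewrite /= (sameP (gdist0P e_conn x y) eqP) eq_sym.
Qed.


(** ** Tightness *)

Lemma card_nbr_at x y j :
  #|[set w | e y w & d x w == j]|%:R =
  radial (fun k => (k == j)%:R) (d x y) :> R.
Proof. by rewrite -sum_indicator (nbr_sum (fun k => (k == j)%:R) (erefl (d x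
  y))). Qed.

Lemma anum1E : (anum e 1)%:R = apar 1.
Proof.
have [x [y dxy]] := exists_gdist e_conn D_gt0 D_gt0.
have exy : e x y by rewrite -gdist1 // dxy.
have es : symmetric e by case: e_conn.
have E : [set w | e x w & e y w] = [set w | e y w & d x w == 1%N].
  by apply/setP => w; rewrite !inE gdist1 // andbC.
rewrite -(card_common_nbr e_dr D_gt0 exy) E card_nbr_at dxy /radial /= mulr1.
by rewrite mulr0 mulr0 add0r addr0.
Qed.

Lemma brD : br D = 1 + q * br D.-1.
Proof. by rewrite -brSl prednK. Qed.

Lemma brD1_ge2 : 2 <= br D.-1.
Proof.
apply: le_trans (br_ge _); rewrite ler_nat.
by case: D D_ge3 => [|[|[|n]]].
Qed.

Lemma bpar1E : bpar 1 = q * br D.-1 * (beta - alpha).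
Proof. by rewrite /bpar brD br1; ring. Qed.

Lemma bpar0E : bpar 0 = br D * beta.
Proof. by rewrite /bpar br0; ring. Qed.

Lemma apar1_beta : apar 1 + 1 = beta + alpha * q * br D.-1.
Proof. by rewrite /apar bpar0E bpar1E brD cpar1; ring. Qed.

Lemma theta1E : theta 1 = br D.-1 * (beta - alpha) - 1.
Proof. by rewrite /theta subn1 br1 mulr1. Qed.

Lemma thetaDE : theta D = - br D.
Proof. by rewrite /theta subnn br0 mul0r add0r. Qed.

Lemma apar1_ge0 : 0 <= apar 1. Proof. by rewrite -anum1E ler0n. Qed.

Lemma beta_gt_alpha : 0 < beta - alpha.
Proof.
have : 0 < bpar 1 by apply: bpar_gt0; apply: leq_trans D_ge3.
by rewrite bpar1E pmulr_rgt0 // mulr_gt0 //; have := q_ge2; have := brD1_ge2;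
  lra.
Qed.

(** The tightness equation, cleared of denominators, is
    (beta - 1 - alpha X) (a_1 + 1) times a positive factor. *)
Lemma tight_beta : tight R e -> beta = 1 + alpha * br D.-1.
Proof.
case=> _ _ _ [th [th_sorted th_spec]].
have -> : th = mkseq theta D.+1.
  apply: (@irr_sorted_eq _ (fun x y : R => y < x)) => //.
  - by move=> y x z /= xy yz; apply: lt_trans xy.
  - apply/(sortedP 0) => i; rewrite size_mkseq ltnS => iD.
    by rewrite !nth_mkseq ?ltnS // 1?ltnW // theta_decr.
  - by move=> a; rewrite th_spec spectrumE.
rewrite !nth_mkseq // anum1E /valency !bnumE //; last exact: leq_trans D_ge3.
rewrite thetaDE theta1E bpar0E bpar1E.
have w_gt0 : 0 < apar 1 + 1 by have := apar1_ge0; lra.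
have -> : apar 1 = beta + alpha * q * br D.-1 - 1 by rewrite -apar1_beta; ring.
rewrite apar1_beta in w_gt0.
have bD := brD; have X2 := brD1_ge2; have q2 := q_ge2; have ba := beta_gt_alpha.
rewrite bD; move: (br D.-1) w_gt0 X2 {bD} => X w_gt0 X2.
rewrite subrK; set w := beta + _ in w_gt0 *.
have wn : w != 0 by rewrite lt0r_neq0.
have E : (X * (beta - alpha) - 1 + (1 + q * X) * beta / w) *
    (- (1 + q * X) + (1 + q * X) * beta / w) +
    (1 + q * X) * beta * (w - 1) * (q * X * (beta - alpha)) / w ^+ 2 =
    (1 + q * X) * q * X * (beta - alpha) * (beta - 1 - alpha * X) / w.
  by rewrite /w; field.
move=> /eqP; rewrite -subr_eq0 opprK E.
rewrite !mulf_eq0 invr_eq0 (negbTE wn) orbF.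
have f1 : 1 + q * X != 0 by rewrite lt0r_neq0 //; nra.
have f2 : q != 0 by rewrite lt0r_neq0 //; lra.
have f3 : X != 0 by rewrite lt0r_neq0 //; lra.
have f4 : beta - alpha != 0 by rewrite lt0r_neq0.
rewrite (negbTE f1) (negbTE f2) (negbTE f3) (negbTE f4) /= -addrA -opprD
  subr_eq0 => /eqP; exact.
Qed.

Hypothesis e_tight : tight R e.
Let X := br D.-1.

Let X_ge2 : 2 <= X. Proof. exact: brD1_ge2. Qed.
Let q2 : 2 <= q. Proof. exact: q_ge2. Qed.
Let X_gt0 : 0 < X. Proof. exact: lt_le_trans X_ge2. Qed.
Let q_gt0 : 0 < q. Proof. exact: lt_le_trans q2. Qed.
Let es : symmetric e. Proof. by case: e_conn. Qed.
Let e_irr : irreflexive e. Proof. by case: e_conn. Qed.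

Lemma betaE : beta = 1 + alpha * X. Proof. exact: tight_beta. Qed.

Lemma apar1E : apar 1 = alpha * (1 + q) * X.
Proof.
have : apar 1 = apar 1 + 1 - 1 by ring.
by rewrite apar1_beta -/X betaE => ->; ring.
Qed.

(** a_1 = alpha (1 + q) X is a cardinality, so alpha >= 0.  If alpha = 0 then
    every a_i vanishes, and the parity of the distance to a vertex is a 2-colouring. *)
Lemma alpha_gt0 : 0 < alpha.
Proof.
have : 0 <= alpha.
  have p : 0 < (1 + q) * X by apply: mulr_gt0 X_gt0; apply: addr_gt0.
  by have := apar1_ge0; rewrite apar1E -mulrA pmulr_lge0.
rewrite le_eqVlt => /orP[/eqP a0|//].
case: e_tight => _ _ nbip _; case: nbip.
have [x _] := exists_gdist e_conn D_gt0 (leq0n D).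
exists (fun y => odd (d x y)) => y z eyz.
have := gdist_nbr e_conn x eyz; have := eyz; rewrite es => ezy.
have := gdist_nbr e_conn x ezy => le1 le2.
have : d x z != d x y.
  apply/eqP => E.
  have : z \in [set w | e y w & d x w == d x y] by rewrite inE eyz E eqxx.
  suff -> : [set w | e y w & d x w == d x y] = set0 by rewrite inE.
  apply: cards0_eq; apply/eqP; rewrite -(@pnatr_eq0 R) card_nbr_at /radial.
  have -> : apar (d x y) = 0 by rewrite /apar /bpar /cpar betaE -a0 br0; ring.
  rewrite [(_.+1 == _)%N]eqn_leq ltnn mulr0 mul0r !addr0.
  by case: (d x y) => [|n]; rewrite ?cpar0 ?mul0r //= eqn_leq ltnn andbF mulr0.
move=> /eqP ne.
have [->|->] : d x z = (d x y).+1 \/ d x y = (d x z).+1 by lia.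
  by rewrite /=; case: odd.
by rewrite /=; case: odd.
Qed.

(** ** Gram matrices of the eigenvalues *)

(** f is the sequence of cosines of the eigenvalue theta_j. *)
Definition eigen j (f : nat -> R) :=
  f 0 = 1 /\ forall i, (i <= D)%N -> radial f i = theta j * f i.

Lemma recurrence_unique j f g : eigen j g ->
  (forall i, (i <= D)%N -> radial f i = theta j * f i) ->
  forall i, (i <= D)%N -> f i = f 0 * g i.
Proof.
move=> [g0 gL] fL.
have apar0 : apar 0 = 0 by rewrite /apar cpar0; ring.
have key i : (i < D)%N -> f i = f 0 * g i /\ f i.+1 = f 0 * g i.+1.
  elim: i => [_|i IH iD].
    split; first by rewrite g0 mulr1.
    have b0 := bpar_gt0 D_gt0; apply: (mulfI (lt0r_neq0 b0)).
    have := fL 0 isT; have := gL 0 isT.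
    rewrite /radial cpar0 apar0 !mul0r !add0r g0 mulr1 => E ->.
    by rewrite mulrCA E mulrC.
  have [E1 E2] := IH (ltnW iD); split=> //.
  have b0 := bpar_gt0 iD; apply: (mulfI (lt0r_neq0 b0)).
  have := fL i.+1 (ltnW iD); have := gL i.+1 (ltnW iD).
  rewrite /radial /= E1 E2 => Eg Ef.
  have -> : bpar i.+1 * f i.+2 = theta j * (f 0 * g i.+1) - cpar i.+1 * (f 0 *
    g i)
     - apar i.+1 * (f 0 * g i.+1) by rewrite -Ef; ring.
  have -> : bpar i.+1 * (f 0 * g i.+2) = f 0 * (bpar i.+1 * g i.+2) by ring.
  have -> : bpar i.+1 * g i.+2 = theta j * g i.+1 - cpar i.+1 * g i - apar i.+1
    * g i.+1.
    by rewrite -Eg; ring.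
  by ring.
case=> [|i] iD; first by rewrite g0 mulr1.
by have [] := key i iD.
Qed.

(** By distance-regularity the left side depends only on d(y,z), and as a function
    of that distance it satisfies the recurrence of f, so it is a multiple of f;
    the factor is its value at distance 0, a sum of squares. *)
Lemma eigen_square j f : eigen j f -> exists2 kappa : R, 0 < kappa &
  forall y z, \sum_w f (d w y) * f (d w z) = kappa * f (d y z).
Proof.
move=> fE; have [f0 fL] := fE.
pose rho i := \sum_(u < D.+1) \sum_(v < D.+1)
  f u * f v * (pnum e i u v)%:R.
have rhoE y z : \sum_w f (d w y) * f (d w z) = rho (d y z).
  rewrite (partition_big (fun w => inord (d y w) : 'I_D.+1) predT) //=.
  apply: eq_bigr => u _.
  rewrite (partition_big (fun w => inord (d z w) : 'I_D.+1) predT) //=.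
  apply: eq_bigr => v _.
  have inordE (x w : T) (i : 'I_D.+1) : (inord (d x w) == i) = (d x w == i).
    by rewrite -val_eqE /= inordK // ltnS gdist_diameter.
  have uD : (u <= D)%N by rewrite -ltnS.
  have vD : (v <= D)%N by rewrite -ltnS.
  rewrite -(pnumE e_dr (gdist_diameter e y z) uD vD (erefl _)).
  rewrite -sum1_card natr_sum mulr_sumr; apply: eq_big => w.
    by rewrite !inordE !inE.
  rewrite !inordE (gdistC e_conn w) (gdistC e_conn w) => /andP[/eqP -> /eqP ->].
  by rewrite mulr1.
have rhoL i : (i <= D)%N -> radial rho i = theta j * rho i.
  move=> /(exists_gdist e_conn D_gt0)[y [z dyz]].
  rewrite -[radial rho i](nbr_sum rho dyz) -dyz -rhoE.
  under eq_bigr => w _ do rewrite -rhoE.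
  rewrite exchange_big mulr_sumr /=; apply: eq_bigr => w _.
  rewrite -mulr_sumr (nbr_sum f (erefl (d w z))) -/(radial f _) fL
    ?gdist_diameter //.
  by ring.
exists (rho 0).
  have [x _] := exists_gdist e_conn D_gt0 (leq0n D).
  have := rhoE x x; rewrite gdistxx // => <-;
    rewrite (bigD1 x) //= gdistxx // f0 mulr1.
  by apply: ltr_wpDr => //; apply: sumr_ge0 => w _; rewrite -expr2 sqr_ge0.
by move=> y z; rewrite rhoE (recurrence_unique fE rhoL) ?gdist_diameter.
Qed.

Let m := 1 + q.
Let r := alpha * (X - 1).
Let t := alpha * (1 + q).

Let k_eq : bpar 0 = (1 + q * X) * (1 + alpha * X).
Proof. by rewrite bpar0E betaE brD. Qed.
Let A_eq : apar 1 = alpha * (1 + q) * X. Proof. exact: apar1E. Qed.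
Let b_eq : bpar 1 = q * X * (1 + alpha * (X - 1)).
Proof. by rewrite bpar1E -/X betaE; ring. Qed.

(** The recurrence at 0 and 1, solved for the first two differences of cosines. *)
Lemma eigen_diff j f : eigen j f ->
  [/\ bpar 0 * f 1%N = theta j,
      bpar 0 * bpar 1 * (f 1 - f 2) = (bpar 0 - theta j) * (1 + theta j)
    & bpar 0 * bpar 1 * (1 - f 2) = (bpar 0 - theta j) * (1 + theta j + bpar
      1)].
Proof.
move=> [f0 fL]; have := fL 0 isT; have := fL 1%N D_gt0.
have apar0 : apar 0 = 0 by rewrite /apar cpar0; ring.
rewrite /radial /= apar0 cpar0 cpar1 f0 !mul0r !add0r mul1r mulr1 => E1 E0.
have aE : apar 1 = bpar 0 - bpar 1 - 1 by rewrite /apar cpar1.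
have E2 : bpar 1 * f 2 = theta j * f 1 - apar 1 * f 1 - 1 by rewrite -E1; ring.
split=> //.
  have -> : bpar 0 * bpar 1 * (f 1 - f 2) =
    bpar 1 * (bpar 0 * f 1) - bpar 0 * (bpar 1 * f 2) by ring.
  have -> : bpar 0 * (bpar 1 * f 2) =
    (theta j - apar 1) * (bpar 0 * f 1) - bpar 0 by rewrite E2; ring.
  by rewrite E0 aE; ring.
have -> : bpar 0 * bpar 1 * (1 - f 2) =
  bpar 0 * bpar 1 - bpar 0 * (bpar 1 * f 2) by ring.
have -> : bpar 0 * (bpar 1 * f 2) = (theta j - apar 1) * (bpar 0 * f 1) - bpar
  0 by rewrite E2; ring.
by rewrite E0 aE; ring.
Qed.

(** ** The local graph *)

Section Local.

Variable x : T.
Definition common u v := #|[set w | [&& e x w, e u w & e v w]]|.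

Lemma local_card : \sum_(y | e x y) 1 = bpar 0 :> R.
Proof.
rewrite -bnumE // -(card_nbr e_dr D_gt0 x) -sum1_card natr_sum.
by apply: eq_bigl => w; rewrite inE.
Qed.

Lemma local_deg u : e x u -> \sum_(y | e x y) (e u y)%:R = apar 1 :> R.
Proof.
move=> xu; rewrite -anum1E -(card_common_nbr e_dr D_gt0 xu).
by rewrite sum_indicator.
Qed.

Lemma local_commonE u v : \sum_(y | e x y) (e u y)%:R * (e y v)%:R =
  (common u v)%:R :> R.
Proof.
rewrite /common -sum1_card natr_sum big_mkcond [RHS]big_mkcond /=.
apply: eq_bigr => w _; rewrite inE (es v).
by case: (e x w); case: (e u w); case: (e w v); rewrite /= ?mulr1 ?mulr0.
Qed.

Lemma local_delta u (F : T -> R) : e x u ->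
  \sum_(y | e x y) (u == y)%:R * F y = F u.
Proof.
move=> xu; rewrite (bigD1 u) //= eqxx mul1r big1 ?addr0 // => y /andP[_ yu].
by rewrite eq_sym (negbTE yu) mul0r.
Qed.

Lemma local_product u v (a0 a1 a2 b0 b1 b2 : R) : e x u -> e x v ->
  \sum_(y | e x y) (a0 + a1 * (e u y)%:R + a2 * (u == y)%:R) *
                   (b0 + b1 * (e y v)%:R + b2 * (y == v)%:R) =
  a0 * b0 * bpar 0 + (a0 * b1 + a1 * b0) * apar 1 + a0 * b2 + a2 * b0
  + a1 * b1 * (common u v)%:R + (a1 * b2 + a2 * b1) * (e u v)%:R
  + a2 * b2 * (u == v)%:R.
Proof.
move=> xu xv.
under eq_bigr => y _.
  rewrite (_ : _ * _ = a0 * b0 * 1 + a0 * b1 * (e v y)%:R + a1 * b0 * (e u y)%:R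
    + a1 * b1 * ((e u y)%:R * (e y v)%:R)
    + b2 * ((v == y)%:R * (a0 + a1 * (e u y)%:R))
    + a2 * ((u == y)%:R * (b0 + b1 * (e y v)%:R + b2 * (y == v)%:R)));
      last first.
    by rewrite (es v) (eq_sym v); ring.
  over.
rewrite !big_split /= -!mulr_sumr local_card !local_deg // local_commonE.
rewrite !local_delta //; ring.
Qed.

Lemma local_eigen j f u y : eigen j f -> e x u -> e x y ->
  f (d u y) - f 1 ^+ 2 =
  (f 2 - f 1 ^+ 2) + (f 1 - f 2) * (e u y)%:R + (1 - f 2) * (u == y)%:R.
Proof.
move=> [f0 _] xu xy; rewrite es in xu.
have := gdist_triangle e_conn u x y.
move: xu xy; rewrite -!(gdist1 e_conn) => /eqP -> /eqP ->; rewrite addn1.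
have -> : (u == y) = (d u y == 0%N).
  by apply/eqP/idP => [->|/(gdist0P e_conn)//]; rewrite (gdistxx e_conn).
by case: (d u y) => [|[|[|]]] //= _; rewrite ?f0; ring.
Qed.

(** The square of [eigen_square], with each column corrected by a multiple of the
    column of x so that its sum over the neighbours of x is 0. *)
Lemma local_gram j f : eigen j f -> exists p : T -> T -> R, exists2 kappa : R,
  0 < kappa & forall y z, e x y -> e x z ->
    kappa * (f (d y z) - f 1 ^+ 2) = \sum_w p w y * p w z.
Proof.
move=> fE; have [kappa k0 H] := eigen_square fE.
exists (fun w y => f (d w y) - f 1 * f (d w x)), kappa => // y z xy xz.
have dy : d x y = 1%N by apply/eqP; rewrite gdist1.
have dz : d x z = 1%N by apply/eqP; rewrite gdist1.
have Hyz := H y z; have Hyx := H y x; have Hxz := H x z; have Hxx := H x x.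
rewrite gdistC // dy in Hyx; rewrite dz in Hxz; rewrite gdistxx // fE.1 in Hxx.
under eq_bigr => w _.
  rewrite (_ : _ * _ = f (d w y) * f (d w z) + (- f 1) * (f (d w y) * f (d w x))
    + (- f 1) * (f (d w x) * f (d w z)) + f 1 ^+ 2 * (f (d w x) * f (d w x)));
      last by ring.
  over.
rewrite !big_split /= -!mulr_sumr Hyz Hyx Hxz Hxx; ring.
Qed.

(** On the neighbours of x the centred matrices of theta_1 and theta_D are
    multiples of A + m - cJ and A - r - c'J, where A is the local adjacency matrix.  Every
    diagonal entry of their product is 0 once beta = 1 + alpha X, so the product
    vanishes by [psd_product_eq0], and this expresses A^2 through A, the identity
    and J. *)
Lemma local_srg u v : e x u -> e x v ->
  (common u v)%:R = (r - m) * (e u v)%:R + m * r * (u == v)%:R + t.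
Proof.
move=> xu0 xv0.
have [f fE] := eigenfunction D_gt0.
have [g gE] := eigenfunction (leqnn D).
have [f1E f12 f02] := eigen_diff fE.
have [g1E g12 g02] := eigen_diff gE.
have k_gt0 : 0 < bpar 0 by apply: bpar_gt0.
have b_gt0 : 0 < bpar 1 by apply: bpar_gt0; apply: leq_trans D_ge3.
have theta0 : theta 0 = bpar 0 by rewrite /theta subn0 bpar0E br0; ring.
have f_ne : f 1 - f 2 != 0.
  have : bpar 0 * bpar 1 * (f 1 - f 2) != 0.
    rewrite f12 mulf_neq0 // lt0r_neq0 //.
      by rewrite subr_gt0 -theta0 theta_lt // D_gt0.
    rewrite theta1E addrCA subrr addr0 mulr_gt0 // beta_gt_alpha //.
  by apply: contraNneq => ->; rewrite mulr0.
have g_ne : g 1 - g 2 != 0.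
  have : bpar 0 * bpar 1 * (g 1 - g 2) != 0.
    rewrite g12 mulf_neq0 //.
      by rewrite lt0r_neq0 // subr_gt0 -theta0 theta_lt // D_gt0 leqnn.
    rewrite thetaDE brD -/X opprD addNKr oppr_eq0 mulf_neq0 // lt0r_neq0 //.
  by apply: contraNneq => ->; rewrite mulr0.
have kn := lt0r_neq0 k_gt0; have bn := lt0r_neq0 b_gt0.
have fm : 1 - f 2 = m * (f 1 - f 2).
  apply: (mulfI (mulf_neq0 kn bn)); rewrite f02 mulrCA f12 mulrCA;
    congr (_ * _).
  by rewrite theta1E b_eq -/X betaE /m; ring.
have gr : 1 - g 2 = - r * (g 1 - g 2).
  apply: (mulfI (mulf_neq0 kn bn)); rewrite g02 mulrCA g12 mulrCA;
    congr (_ * _).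
  by rewrite thetaDE b_eq brD -/X /r; ring.
have rowsum j h : eigen j h ->
    (h 2 - h 1 ^+ 2) * bpar 0 + (h 1 - h 2) * apar 1 + (1 - h 2) = 0.
  move=> [h0 hL]; have := hL 0 isT; have := hL 1%N D_gt0.
  have apar0 : apar 0 = 0 by rewrite /apar cpar0; ring.
  rewrite /radial /= apar0 cpar0 cpar1 h0 !mul0r !add0r mul1r mulr1 => E1 E0.
  have aE : apar 1 = bpar 0 - bpar 1 - 1 by rewrite /apar cpar1.
  have -> : (h 2 - h 1 ^+ 2) * bpar 0 + (h 1 - h 2) * apar 1 + (1 - h 2) =
    (1 + apar 1 * h 1 + bpar 1 * h 2) - h 1 * (bpar 0 * h 1) by rewrite aE;
      ring.
  by rewrite E1 E0; ring.
have fs := rowsum _ _ fE; have gs := rowsum _ _ gE.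
have [p [kf kf0 pE]] := local_gram fE.
have [p' [kg kg0 p'E]] := local_gram gE.
pose Nf y z := kf * (f (d y z) - f 1 ^+ 2).
pose Ng y z := kg * (g (d y z) - g 1 ^+ 2).
pose c := kf * kg * ((f 1 - f 2) * (g 1 - g 2)).
have prodE a a' : e x a -> e x a' -> \sum_(y | e x y) Nf a y * Ng y a' =
    c * ((common a a')%:R - ((r - m) * (e a a')%:R + m * r * (a == a')%:R + t)).
  move=> xa xa'.
  have -> : \sum_(y | e x y) Nf a y * Ng y a' = kf * kg *
      \sum_(y | e x y) ((f 2 - f 1 ^+ 2) + (f 1 - f 2) * (e a y)%:R + (1 - f 2)
        * (a == y)%:R)
      * ((g 2 - g 1 ^+ 2) + (g 1 - g 2) * (e y a')%:R + (1 - g 2) * (y ==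
        a')%:R).
    rewrite mulr_sumr; apply: eq_bigr => y xy.
    by rewrite /Nf /Ng (local_eigen fE) // (local_eigen gE) //; ring.
  rewrite local_product // /c -!mulrA; congr (_ * (_ * _)).
  (* The row sums eliminate the coefficients of J. *)
  have f0E : f 2 - f 1 ^+ 2 = - (f 1 - f 2) * (apar 1 + m) / bpar 0.
    apply: (mulIf kn); rewrite divfK // -[LHS]addr0 -[X in _ + X]oppr0 -fs fm;
      ring.
  have g0E : g 2 - g 1 ^+ 2 = - (g 1 - g 2) * (apar 1 - r) / bpar 0.
    apply: (mulIf kn); rewrite divfK // -[LHS]addr0 -[X in _ + X]oppr0 -gs gr;
      ring.
  rewrite fm gr f0E g0E.
  move: (f 1 - f 2) (g 1 - g 2) => F G.
  rewrite A_eq; move: kn; rewrite k_eq => kn.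
  rewrite /m /r /t; field; by move: kn; rewrite mulf_eq0 negb_or andbC.
have : \sum_(y | e x y) Nf u y * Ng y v = 0.
  apply: (psd_product_eq0 pE p'E) => //.
  rewrite big1 // => y xy; rewrite -/(Nf _ _);
    under eq_bigr => z _ do rewrite -/(Nf y z) -/(Ng z y).
  rewrite prodE // e_irr eqxx -local_commonE.
  under eq_bigr => z _ do rewrite (es z) -natrM mulnb andbb.
  by rewrite local_deg // A_eq /m /r /t /=; ring.
rewrite prodE //; move/eqP; rewrite mulf_eq0 /c !mulf_eq0.
rewrite (negbTE f_ne) (negbTE g_ne) (gt_eqF kf0) (gt_eqF kg0) /= subr_eq0.
by move/eqP.
Qed.

(** f is the rank of the projection (A + m - cJ) / (r + m) onto the eigenspace of
    r; its trace gives the equation.  Its entries off the diagonal take two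
    values, so [two_distance_bound] applies. *)
Lemma local_rank : exists f : nat,
  f%:R * (r + m) = m * q * X * (1 + alpha * X) /\
  bpar 0 <= f.+1%:R ^+ 2.
Proof.
have al := alpha_gt0.
have rm_gt0 : 0 < r + m.
  apply: ltr_wpDl; last exact: addr_gt0.
  by rewrite mulr_ge0 ?(ltW al) // subr_ge0; have := X_ge2; lra.
have rmn := lt0r_neq0 rm_gt0.
have kn : 1 + q * X != 0 by rewrite lt0r_neq0 // addr_gt0 // mulr_gt0.
(* The row sums of A + m - cJ vanish for this c, as apar 1 + m = c * bpar 0. *)
pose c := m / (1 + q * X).
pose p y z := if e x y && e x z then
  (- c + 1 * (e y z)%:R + m * (y == z)%:R) / (r + m) else 0.
have pp y z : \sum_w p y w * p w z = p y z.
  rewrite /p; have [/andP[xy xz]|n] := boolP (e x y && e x z); last first.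
    apply: big1 => w _; case/nandP: n => /negbTE ->; rewrite ?mul0r //.
    by rewrite andbF mulr0.
  rewrite xy xz /= (bigID (e x)) /= [X in _ + X]big1 ?addr0; last first.
    by move=> w /negbTE ->; rewrite mul0r.
  under eq_bigr => w -> do rewrite /= mulrACA.
  rewrite -mulr_suml local_product // local_srg // A_eq k_eq.
  rewrite /c /r /m /t; rewrite /r /m in rmn; field.
  by rewrite rmn kn.
have [f [u [v [puv tr]]]] := idempotent_factor pp.
exists f; split.
  rewrite -tr (bigID (e x)) /= [X in _ + X]big1 ?addr0; last first.
    by move=> w /negbTE xw; rewrite /p xw.
  under eq_bigr => w xw do rewrite /p xw /= e_irr eqxx mulr0 addr0 mulr1 -[_ /
    _]mulr1.
  rewrite -mulr_sumr local_card k_eq /c mulrAC divfK //; field; exact: kn.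
have -> : bpar 0 = #|[set w | e x w]|%:R.
  by rewrite (card_nbr e_dr) // bnumE.
rewrite -natrX ler_nat -mulnn.
pose a := (1 - c) / (r + m); pose a' := - c / (r + m).
have mn : m != 0 by rewrite lt0r_neq0 // addr_gt0.
have qn : q != 0 by rewrite lt0r_neq0.
apply: (@two_distance_bound R T _ f u v a a' (q * m / (r + m) ^+ 2)).
  by rewrite mulf_neq0 ?invr_neq0 ?expf_neq0 // mulf_neq0.
move=> y z; rewrite !inE -puv /p => -> -> /=.
have [->|yz] := eqVneq y z.
  by rewrite e_irr mulr0n mulr1n mulr0 addr0 mulr1 /a /a' /m;
    rewrite /m in rmn; field.
by case: (e y z); rewrite ?mulr0n ?mulr1n /a /a' ?mulr0 ?mulr1 ?addr0; field.
Qed.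

End Local.

(** ** Common neighbours of two vertices at distance 2 *)

Section MuGraph.

Variables x z : T.
Hypothesis dxz : d x z = 2.

Let dzx : d z x = 2. Proof. by rewrite gdistC. Qed.

Lemma common_as_sum u : (common x u z)%:R =
  \sum_(w | e x w && e z w) (e u w)%:R :> R.
Proof.
rewrite sum_indicator; congr (_%:R); apply: eq_card => w; rewrite !inE.
by case: (e x w); case: (e u w); case: (e z w).
Qed.

Lemma mu_graph_card : #|[set w | e x w & e z w]| = cnum e 2.
Proof.
rewrite -(card_nbr_closer e_dr D_gt0 dzx).
by apply: eq_card => w; rewrite !inE (gdist1 e_conn).
Qed.

Lemma cnum2E : (cnum e 2)%:R = m * (1 + alpha) :> R.
Proof.
rewrite cnumE; last by rewrite /= (leq_trans _ D_ge3).
by rewrite /cpar /= br1 mulr1 brSl br1 mulr1.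
Qed.

Let mu_graph_sum1 : \sum_(w | e x w && e z w) 1 = m * (1 + alpha) :> R.
Proof.
rewrite -cnum2E -mu_graph_card -sum1_card natr_sum.
by apply: eq_bigl => w; rewrite inE.
Qed.

Let z_nadj : e x z = false. Proof. by rewrite -(gdist1 e_conn) dxz. Qed.
Let z_neq : (x == z) = false.
Proof. by apply/eqP => xz; move: dxz; rewrite xz gdistxx. Qed.

Lemma mu_graph_deg y : e x y -> e z y -> (common x y z)%:R = t.
Proof.
move=> xy zy.
have -> : common x y z = common y x z.
  by apply: eq_card => w; rewrite !inE andbCA.
by rewrite local_srg ?(es y) // z_nadj z_neq mulr0n !mulr0 !add0r.
Qed.

Lemma sum_common : \sum_(u | e x u) (common x u z)%:R =
  m * (1 + alpha) * apar 1.
Proof.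
under eq_bigr => u _ do rewrite common_as_sum.
rewrite exchange_big /= -mu_graph_sum1 mulr_suml;
  apply: eq_bigr => w /andP[xw _].
rewrite mul1r -(local_deg xw); apply: eq_bigr => u _; by rewrite es.
Qed.

(** Exchanging sums, this adds up [local_srg] over all pairs of common neighbours
    of x and z. *)
Lemma sum_common2 : \sum_(u | e x u) (common x u z)%:R ^+ 2 =
  m * (1 + alpha) * ((r - m) * t + m * r + t * (m * (1 + alpha))).
Proof.
under eq_bigr => u _ do rewrite expr2 common_as_sum big_distrlr /=.
rewrite exchange_big /= -mu_graph_sum1 mulr_suml;
  apply: eq_bigr => w /andP[xw zw].
rewrite exchange_big /= mul1r.
under eq_bigr => w' /andP[xw' zw'].
  rewrite (_ : \sum_(i | e x i) _ = (common x w w')%:R); last first.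
    by rewrite -local_commonE; apply: eq_bigr => u _; rewrite (es w).
  rewrite local_srg //; over.
rewrite !big_split /= -!mulr_sumr -common_as_sum mu_graph_deg //.
congr (_ + _ + _); last first.
  rewrite /t -mulrA; congr (_ * _); rewrite mulr_sumr.
  by apply: eq_bigr => *; rewrite mulr1.
rewrite (bigD1 w) /=; last by rewrite xw zw.
rewrite eqxx big1 ?addr0 ?mulr1 // => w' /andP[_ ne].
by rewrite eq_sym (negbTE ne).
Qed.

Lemma sum_far : \sum_(u | e x u && (d z u == 2%N)) 1 =
  m ^+ 2 * alpha * (X - 1) :> R.
Proof.
have -> : \sum_(u | e x u && (d z u == 2%N)) 1 =
  #|[set u | e x u & d z u == 2%N]|%:R :> R.
  by rewrite -sum1_card natr_sum; apply: eq_bigl => u; rewrite inE.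
rewrite card_nbr_at dzx /radial /= !mulr0 add0r addr0 mulr1.
rewrite /apar k_eq /bpar /cpar /= brD -/X betaE brSl br1 /m; ring.
Qed.

(** A neighbour u of x at distance 3 from z has no neighbour among the common
    neighbours of x and z.  For those at distance 2 the first two moments of the
    number of such neighbours give variance 0 around 1 + alpha. *)
Lemma mu_graph_outside u : e x u -> ~~ e z u ->
  (common x u z)%:R = 0 :> R \/ (common x u z)%:R = 1 + alpha.
Proof.
have split (F : T -> R) : \sum_(u | e x u) F u = \sum_(u | e x u && e z u) F u
    + \sum_(u | e x u && (d z u == 2%N)) F u
    + \sum_(u | e x u && (2 < d z u)%N) F u.
  rewrite (bigID (e z)) /= -addrA; congr (_ + _).
  rewrite (bigID (fun u => d z u == 2%N)) /=; congr (_ + _);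
    apply: eq_bigl => v.
    by rewrite -(gdist1 e_conn z); case: eqP => [->|_]; rewrite ?andbF ?andbT.
  rewrite -andbA; case xv: (e x v) => //=.
  have := gdist_nbr e_conn z (y := v) (z := x); rewrite es xv dzx => /(_ isT).
  rewrite -(gdist1 e_conn z); by case: (d z v) => [|[|[|]]].
have far0 v : e x v && (2 < d z v)%N -> (common x v z)%:R = 0 :> R.
  move=> /andP[xv dv]; rewrite common_as_sum big1 // => w /andP[xw zw].
  case vw: (e v w) => //; have := gdist_nbr e_conn z (y := w) (z := v).
  rewrite es vw => /(_ isT); move: zw; rewrite -(gdist1 e_conn z) => /eqP ->.
  by rewrite leqNgt dv.
(* The sum of (common x u z - (1 + alpha)) ^ 2, expanded with [sum_common],
   [sum_common2] and [sum_far]; each common neighbour of x and z sees t others. *)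
have var0 : \sum_(u | e x u && (d z u == 2%N))
    ((common x u z)%:R - (1 + alpha)) ^+ 2 = 0.
  have := sum_common; have := sum_common2; rewrite !split.
  rewrite [X in _ + _ + X = _ -> _]big1; last by move=> v /far0 ->;
    rewrite expr0n.
  rewrite [X in _ -> _ + _ + X = _ -> _]big1 //.
  rewrite (eq_bigr (fun _ => t ^+ 2 * 1)); last first.
    by move=> v /andP[xv zv]; rewrite mu_graph_deg // mulr1.
  rewrite [\sum_(u | e x u && e z u) _ in X in _ -> X ->
    _](eq_bigr (fun _ => t * 1)); last first.
    by move=> v /andP[xv zv]; rewrite mu_graph_deg // mulr1.
  rewrite -!mulr_sumr mu_graph_sum1 !addr0 => E2 E1.
  rewrite (eq_bigr (fun u => (common x u z)%:R ^+ 2 + (- 2 * (1 + alpha)) *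
    (common x u z)%:R
    + (1 + alpha) ^+ 2 * 1)); last by move=> v _; ring.
  rewrite !big_split /= -!mulr_sumr sum_far.
  have -> : \sum_(u | e x u && (d z u == 2%N)) (common x u z)%:R ^+ 2 =
     m * (1 + alpha) * ((r - m) * t + m * r + t * (m * (1 + alpha))) - t ^+ 2 *
       (m * (1 + alpha)).
    by rewrite -E2; ring.
  have -> : \sum_(u | e x u && (d z u == 2%N)) (common x u z)%:R =
     m * (1 + alpha) * apar 1 - t * (m * (1 + alpha)).
    by rewrite -E1; ring.
  by rewrite A_eq /m /r /t; ring.
move=> xu nzu; have [le2|gt2] := leqP (d z u) 2; last first.
  by left; apply: far0; rewrite xu.
right; have du : d z u = 2.
  have := gdist_nbr e_conn z (y := u) (z := x); rewrite es xu dzx => /(_ isT).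
  by move: nzu le2; rewrite -(gdist1 e_conn z); case: (d z u) => [|[|[|]]].
have /eqP := var0; rewrite psumr_eq0 => [|v _]; last exact: sqr_ge0.
move=> /allP/(_ u (mem_index_enum _)); rewrite xu du /= sqrf_eq0 subr_eq0.
by move/eqP.
Qed.

End MuGraph.

(** ** The bound on the diameter *)

(** For alpha = h the local graph and the sets of common neighbours of x and a
    vertex z at distance 2 satisfy the hypotheses of
    [closed_subsets_contradiction], with l = h n.  Nonadjacent u and v have
    c_2 = m h + m common neighbours: x, the m h in the local graph, and m - 1 > 0
    others, any of which can serve as z. *)
Lemma local_net_bound (p n h : nat) :
    q = p%:R -> X = n%:R -> alpha = h%:R -> (2 <= p)%N -> (2 <= h)%N ->
  (h * n <= 9 * (p.+1 * (p.+1 * (p.+1 * h))))%N.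
Proof.
move=> qE XE aE p2 h2; rewrite leqNgt; apply/negP => large.
have mE : m = p.+1%:R by rewrite /m qE -natr1 addrC.
have [x _] := exists_gdist e_conn D_gt0 (leq0n D).
pose Delta := [set y | e x y].
pose adj : rel T := fun y z => [&& e x y, e x z & e y z].
have adj_sym : symmetric adj by move=> y z; rewrite /adj (es y z) andbCA.
have adj_irr : irreflexive adj by move=> y; rewrite /adj e_irr !andbF.
have adj_in y z : adj y z -> y \in Delta by rewrite inE => /and3P[].
have NE y : e x y -> [set z | adj y z] = [set z | e x z & e y z].
  by move=> xy; apply/setP => z; rewrite !inE /adj xy.
have comE y z : e x y -> e x z ->
    #|[set w | adj y w] :&: [set w | adj z w]| = common x y z.
  move=> xy xz; rewrite !NE //; apply: eq_card => w; rewrite !inE.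
  by case: (e x w); case: (e y w).
have degN y : y \in Delta -> #|[set z | adj y z]| = (p.+1 * (h * n))%N.
  rewrite inE => xy; rewrite NE // (card_common_nbr e_dr) //; apply/eqP.
  rewrite -(eqr_nat R) anum1E A_eq aE qE XE !natrM -natr1; apply/eqP; ring.
have lamN y z : adj y z ->
    (#|[set w | adj y w] :&: [set w | adj z w]|).+1 =
      (h * n + p.+1.-1 * h.-1)%N.
  move=> /and3P[xy xz yz]; rewrite comE //; apply/eqP; rewrite -(eqr_nat R).
  have -> : h = h.-1.+1 by case: (h) h2.
  rewrite -natr1 local_srg // yz; have -> : (y == z) = false.
    by apply: contraTF yz => /eqP ->; rewrite e_irr.
  rewrite natrD !natrM /= mulr0n mulr0 addr0 mulr1 /r /t -/m mE XE aE.
  have -> : h%:R = h.-1%:R + 1 :> R by rewrite natr1 prednK // (leq_trans _ h2).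
  by rewrite -!natr1; apply/eqP; ring.
have tE : t = (p.+1 * h)%:R by rewrite /t -/m mE aE natrM mulrC.
have muN y z : y \in Delta -> z \in Delta -> y != z -> ~~ adj y z ->
    #|[set w | adj y w] :&: [set w | adj z w]| = (p.+1 * h)%N.
  rewrite ![_ \in Delta]inE => xy xz yz; rewrite {1}/adj xy xz /= => nyz.
  rewrite comE //; apply/eqP; rewrite -(eqr_nat R) local_srg //.
  by rewrite (negbTE nyz) (negbTE yz) mulr0n !mulr0 !add0r tE.
have c2E : cnum e 2 = (p.+1 * h.+1)%N.
  by apply/eqP; rewrite -(eqr_nat R) cnum2E mE aE natrM -[h.+1%:R]natr1 addrC.
have [y xy] : exists y, e x y.
  have /card_gt0P[y] : (0 < #|[set w | e x w]|)%N by rewrite (card_nbr e_dr) //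
    bnum_gt0.
  by rewrite inE; exists y.
apply: (@closed_subsets_contradiction _ Delta adj adj_sym adj_irr adj_in p.+1 h
  (h * n) p2 h2 degN lamN muN large y); first by rewrite inE.
move=> u v; rewrite !inE => xu xv uv; rewrite /adj xu xv /= => nuv.
have [z [xz zu zv]] : exists z, [/\ d x z = 2, e z u & e z v].
  have duv : d u v = 2.
    have := gdist_nbr e_conn u (y := x) (z := v); rewrite xv => /(_ isT).
    have -> : d u x = 1%N by apply/eqP; rewrite (gdist1 e_conn) es.
    have d0 : d u v != 0%N by apply: contra uv => /(gdist0P e_conn) ->.
    by move: nuv d0; rewrite -(gdist1 e_conn); case: (d u v) => [|[|[|]]].
  have cardB : #|[set w | e v w & d u w == 1%N]| = (p.+1 * h.+1)%N.
    by rewrite (card_nbr_closer e_dr D_gt0 duv).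
  pose S := x |: ([set w | adj u w] :&: [set w | adj v w]).
  have cardS : (#|S| <= (p.+1 * h).+1)%N.
    rewrite -(muN u v) ?inE //; last by rewrite /adj xu xv.
    by rewrite cardsU1; case: (_ \notin _); rewrite ?add1n ?add0n.
  have /subsetPn[z] : ~~ ([set w | e v w & d u w == 1%N] \subset S).
    apply/negP => /subset_leq_card; rewrite cardB => /leq_trans/(_ cardS).
    by rewrite mulnS; lia.
  rewrite !inE (gdist1 e_conn) => /andP[vz uz]; rewrite /adj xu xv vz uz /=.
  rewrite !andbT andbb negb_or => /andP[zx nxz].
  exists z; split; rewrite 1?es //.
  have := gdist_nbr e_conn x (y := u) (z := z); rewrite uz => /(_ isT).
  have -> : d x u = 1%N by apply/eqP; rewrite (gdist1 e_conn).
  have d0 : d x z != 0%N by apply: contra zx => /(gdist0P e_conn) ->.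
  by move: nxz d0; rewrite -(gdist1 e_conn); case: (d x z) => [|[|[|]]].
exists [set w | e x w & e z w]; split; last 2 first.
- by rewrite inE xu.
- by rewrite inE xv.
have NC a : e x a -> #|[set w | adj a w] :&: [set w | e x w & e z w]| =
  common x a z.
  move=> xa; rewrite NE //; apply: eq_card => w; rewrite !inE.
  by case: (e x w); case: (e a w).
split.
- by apply/subsetP => w; rewrite !inE => /andP[].
- by rewrite (mu_graph_card xz).
- move=> a; rewrite inE => /andP[xa za]; rewrite NC //.
  by apply/eqP; rewrite -(eqr_nat R) (mu_graph_deg xz) // tE.
move=> a; rewrite [a \in Delta]inE => xa; rewrite NC // inE xa /= => za.
have [E|E] := mu_graph_outside xz xa za; [left|right]; apply/eqP.
  by rewrite -(eqr_nat R) E.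
by rewrite -(eqr_nat R) E aE -natr1 addrC.
Qed.

(** Since D - 1 <= X, it suffices to bound X.  The two values of t excluded in
    [multiplicity_dvd] are alpha = q and alpha = q + 1. *)
Lemma tight_diameter_bound : (D <= diameter_bound `|b|)%N.
Proof.
set p := `|b|%N.
have bE : b = p%:Z by rewrite /p gez0_abs // (le_trans _ b_ge2).
have p2 : (2 <= p)%N by rewrite -lez_nat -bE.
have p_gt0 : (0 < p)%N := ltnW p2.
have qE : q = p%:R by rewrite /q bE.
pose n := (\sum_(j < D.-1) p ^ j)%N.
have XE : X = n%:R.
  rewrite /X /br /gauss1 -/q natr_sum qE.
  by apply: eq_bigr => j _; rewrite natrX.
have n2 : (2 <= n)%N by rewrite -(ler_nat R) -XE X_ge2.
suff n_le : (n < diameter_bound p)%N.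
  have Dn : (D.-1 <= n)%N by rewrite -(ler_nat R) -XE; apply: br_ge.
  by rewrite -[D]prednK //; apply: leq_ltn_trans n_le.
have mE : m = p.+1%:R by rewrite /m qE -natr1 addrC.
have al := alpha_gt0.
have [s tE] : exists s : nat, t = s%:R.
  have c2 : (cnum e 2)%:R = p.+1%:R + t by rewrite cnum2E -mE /m /t; ring.
  exists (cnum e 2 - p.+1)%N; rewrite natrB ?c2; first by ring.
  by rewrite -(ler_nat R) c2 lerDl mulr_ge0 ?ltW // addr_gt0.
have s_gt0 : (0 < s)%N by rewrite -(ltr_nat R) -tE mulr_gt0 // addr_gt0.
have [x _] := exists_gdist e_conn D_gt0 (leq0n D).
have [f [fE kE]] := local_rank x.
have n1 : n.-1%:R = X - 1.
  by rewrite XE -[n in n%:R - 1]prednK ?(ltnW n2) // -natr1 addrK.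
have fE' : (f * (s * n.-1 + p.+1 * p.+1) = n * p.+1 * p * (p.+1 + s * n))%N.
  apply/eqP; rewrite -(eqr_nat R) !(natrM, natrD) n1 -tE -XE -mE -qE.
  have -> : f%:R * (t * (X - 1) + m * m) = m * (f%:R * (r + m)).
    by rewrite /t -/m /r; ring.
  by rewrite fE /t -/m; apply/eqP; ring.
have kE' : ((1 + p * n) * (p.+1 + s * n) <= p.+1 * (f.+1 * f.+1))%N.
  rewrite -(ler_nat R) !(natrM, natrD) -tE -XE -mE -qE.
  have -> : (1 + q * X) * (m + t * X) = m * bpar 0 by rewrite k_eq /t -/m; ring.
  by rewrite ler_pM2l -?expr2 // addr_gt0.
have s_le := multiplicity_bound p_gt0 n2 s_gt0 fE' kE'.
have small h : alpha = h%:R -> (2 <= h)%N -> (n < diameter_bound p)%N.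
  move=> aE h2; have := local_net_bound qE XE aE p2 h2.
  have -> : (9 * (p.+1 * (p.+1 * (p.+1 * h))) =
    h * (9 * (p.+1 * (p.+1 * p.+1))))%N by ring.
  rewrite leq_pmul2l ?(ltnW h2) // => /leq_ltn_trans; apply.
  by rewrite ltnS leq_addl.
have mn : m != 0 by rewrite lt0r_neq0 // addr_gt0.
have [s1|s1] := eqVneq s (p.+1 * p)%N.
  apply: (small p) => //; apply: (mulIf mn).
  by rewrite [LHS]tE s1 natrM mE mulrC.
have [s2|s2] := eqVneq s (p.+1 * p.+1)%N.
  apply: (small p.+1); last exact: leq_trans p2 _.
  by apply: (mulIf mn); rewrite [LHS]tE s2 natrM mE.
have := multiplicity_dvd (ltnW n2) s_gt0 fE' s1 s2 p_gt0.
move=> /leq_ltn_trans; apply; rewrite ltnS; apply: leq_trans (leq_addr _ _).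
by rewrite leq_mul2l leq_mul ?leq_add2r ?orbT.
Qed.

End Classical.

Theorem corollary7p4 (R : realType) :
  exists g : int -> nat,
    forall (T : finType) (e : rel T) (D : nat) (b : int) (alpha beta : R),
      (3 <= D)%N -> 2 <= b ->
      tight R e -> classical_parameters e D b alpha beta ->
      (D <= g b)%N.
Proof.
exists (fun b => diameter_bound `|b|) => T e D b alpha beta _ b_ge2 e_tight cl.
have DE : diameter e = D by case: cl.
by rewrite -DE in cl *; apply: tight_diameter_bound cl b_ge2 e_tight.
Qed.
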